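(* For any integer $g\geq 2$, there exists a domain $\Omega \subset \mathbb{C}$ of connectivity $g+1$ such that for some $0<r_2<r_1$ and some $z_0\in \Omega$, we have: (i) $B_{c_{\Omega}}(z_{0};r_{1})$ is disconnected and relatively compact in $\Omega$; (ii) $\overline{B_{c_{\Omega}}(z_{0};r_{2})} \subsetneq \overline{B}_{c_{\Omega}}(z_{0};r_{2})$.
   Context: A domain in $\mathbb{C}$ has connectivity $g+1$ if its complement in the extended complex plane has exactly $g+1$ connected components. $\mathbb{D}$ is the open unit disk. For a domain $\Omega\subsetneq\mathbb{C}$ let $\mathcal{H}(\Omega)$ be the set of holomorphic maps of $\Omega$ into $\mathbb{D}$. The Möbius pseudodistance is $c^{*}_{\Omega}(z,z_0)=\sup\{|f(z)|: f\in\mathcal{H}(\Omega), f(z_0)=0\}$ and the Carathéodory pseudodistance is $c_{\Omega}(z,z_0)=\tanh^{-1}(c^{*}_{\Omega}(z,z_0))$. For $a\in\Omega$ and $r>0$, $B_{c_{\Omega}}(a;r)=\{z\in\Omega: c_{\Omega}(z,a)<r\}$ is the open ball and $\overline{B}_{c_{\Omega}}(a;r)=\{z\in\Omega: c_{\Omega}(z,a)\le r\}$ is the closed ball, while $\overline{B_{c_{\Omega}}(a;r)}$ denotes the closure of the open ball in $\Omega$ with respect to the Euclidean topology of $\Omega$. *)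

(* Defs.v *)
From HB Require Import structures.
From mathcomp Require Export all_boot all_order all_algebra.
From mathcomp Require Export all_classical all_reals all_analysis.
From mathcomp Require Export complex.

Set Implicit Arguments.
Unset Strict Implicit.
Unset Printing Implicit Defensive.

Import Order.TTheory GRing.Theory Num.Theory.
Import numFieldNormedType.Exports.
Export numFieldNormedType.Exports.

Local Open Scope classical_set_scope.
Local Open Scope ring_scope.

Section caratheodory.
Variable R : realType.

(* The alias [^o] gives R[i] its structure of normed space over itself, hence
   the Euclidean topology; [derivable] on it is complex differentiability. *)
Local Notation C := (R[i]^o).

Definition modulus (w : C) : R := Normc.normc w.

Definition domain (Omega : set C) : Prop :=
  [/\ open Omega, Omega !=set0 & connected Omega].

Definition components (T : topologicalType) (A : set T) : set (set T) :=
  [set connected_component A x | x in A].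

(* The Riemann sphere is the one-point compactification of C, in which C is
   embedded by [Some]. *)
Definition has_connectivity (Omega : set C) (n : nat) : Prop :=
  (components (~` (Some @` Omega : set (one_point_compactification C)))
     #= `I_n)%card.

Definition holomorphic_on (Omega : set C) (f : C -> C) : Prop :=
  forall z, Omega z -> derivable f z 1.

(* A map on Omega is represented by a total function, whose values outside of
   Omega are irrelevant when Omega is open. *)
Definition hol_to_disk (Omega : set C) : set (C -> C) :=
  [set f | holomorphic_on Omega f /\ forall z, Omega z -> modulus (f z) < 1].

Definition mobius_dist (Omega : set C) (z z0 : C) : R :=
  sup [set modulus (f z) | f in [set f | hol_to_disk Omega f /\ f z0 = 0]].

(* Inverse hyperbolic tangent on [0, 1], with value +oo at 1. *)
Definition artanh (x : R) : \bar R :=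
  if x < 1 then (ln ((1 + x) / (1 - x)) / 2)%:E else +oo%E.

(* On a domain, [mobius_dist] is < 1 and the distance below is finite. *)
Definition caratheodory_dist (Omega : set C) (z z0 : C) : \bar R :=
  artanh (mobius_dist Omega z z0).

Definition cball (Omega : set C) (a : C) (r : R) : set C :=
  [set z | Omega z /\ (caratheodory_dist Omega z a < r%:E)%E].

Definition closed_cball (Omega : set C) (a : C) (r : R) : set C :=
  [set z | Omega z /\ (caratheodory_dist Omega z a <= r%:E)%E].

Definition closure_in (Omega A : set C) : set C := Omega `&` closure A.

Definition relatively_compact_in (Omega A : set C) : Prop :=
  compact (closure_in Omega A).

End caratheodory.

(* Main.v *)
Require Import Defs.
From mathcomp Require Import ring lra zify.
From mathcomp Require cyclic separable cyclotomic.

(** Put n = g + 1 >= 3, let w be a primitive n-th root of unity and use the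
    coordinate zeta = 1 + 1/z on the sphere, so that the base point z = 0 is
    zeta = oo and the point z = -1 is zeta = 0.  The domain is the complement
    of the n small discs |zeta - w^j| <= e; as w^0 = 1, one of them contains
    z = oo, so that in the coordinate z the domain is a large disc minus g
    small discs ([circ_domain]).

    To first order in e, the holomorphic functions on this domain that are
    bounded by 1 and vanish at zeta = oo are the sums of the
    a_j e / (zeta - w^j) with |a_j| <= 1, so the Moebius distance to the base
    point is approximately e times the sum of the 1/|zeta - w^j|.  The function
    1/|zeta| is strictly subharmonic on the plane minus 0.  By symmetry the
    centre zeta = 0 is a critical point of the sum, with a Hessian that is a
    multiple of the identity when n >= 3 (for n = 2 it is a saddle); hence the
    centre is a strict local minimum.  More precisely the sum is n at the
    centre and at least n (1 + r^2/8) on the circle |zeta| = r, r <= 1/12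
    ([sum_inv_dist]), and for small e this gap exceeds the error of the
    approximation ([barrier_gap]).

    Let rho be a lower bound for the distance on the circle |zeta| = 1/12 that
    exceeds the distance at the centre.  The ball {distance < rho} contains
    zeta = oo and zeta = 0 and misses the circle that separates them, so it is
    disconnected.  Since rho is of the order of e, the same lower bound for the
    distance keeps that ball away from the holes.  The minimum m of the distance
    on the disc |zeta| <= 1/12 is attained inside the circle.  At the radius of
    m the open ball does not meet the interior of the disc while the closed ball
    does, so the closure of the former is smaller than the latter.

    The lower bound needs explicit functions only ([mobius_dist_ge_sum]).  An
    upper bound is needed at the centre alone, and there the symmetry gives it
    ([symmetric_upper_bound]): the mean F of f over the rotations
    zeta -> w^j zeta has the same value as f at the centre and vanishes to order
    n at zeta = oo, so F (zeta^n - 1) has no pole, and the maximum principle on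
    the region |zeta^n - 1| >= d bounds |f| at the centre by d.  That region lies
    in the domain as soon as d is slightly larger than n e.

    The maximum principle and the Taylor estimate that are used here follow from
    Cauchy's formula on squares, itself a consequence of Goursat's lemma. *)

Set Implicit Arguments.
Unset Strict Implicit.
Unset Printing Implicit Defensive.
Import Order.TTheory GRing.Theory Num.Theory.

Local Open Scope classical_set_scope.
Local Open Scope ring_scope.
Local Open Scope complex_scope.

(** * The modulus, the topology of the complex plane and holomorphy *)

Section modulus.
Variable R : realType.
Local Notation C := (R[i]^o).
Local Notation abs := (@modulus R).
Implicit Types (z w u v : C) (r e : R).

Lemma normE z : `|z| = (abs z)%:C%C :> R[i].
Proof. by []. Qed.

Lemma modulus_ge0 z : 0 <= abs z.
Proof. by rewrite -lecR -normE normr_ge0. Qed.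

Lemma modulus0 : abs 0 = 0.
Proof. exact: Normc.normc0. Qed.

Lemma modulus1 : abs 1 = 1.
Proof. exact: Normc.normc1. Qed.

Lemma modulus_eq0 z : (abs z == 0) = (z == 0).
Proof.
apply/eqP/eqP => [/Normc.eq0_normc //|->]; exact: modulus0.
Qed.

Lemma modulus_gt0 z : (0 < abs z) = (z != 0).
Proof. by rewrite lt_def modulus_ge0 andbT modulus_eq0. Qed.

Lemma modulusM z w : abs (z * w) = abs z * abs w.
Proof. exact: Normc.normcM. Qed.

Lemma modulusV z : abs (z^-1) = (abs z)^-1.
Proof.
have [->|z0] := eqVneq z 0; first by rewrite !(invr0, modulus0).
have nz0 : abs z != 0 by rewrite modulus_eq0.
by apply: (mulfI nz0); rewrite -modulusM !mulfV // modulus1.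
Qed.

Lemma modulusX z k : abs (z ^+ k) = abs z ^+ k.
Proof.
by elim: k => [|k IH]; rewrite ?expr0 ?modulus1 // !exprS modulusM IH.
Qed.

Lemma modulusN z : abs (- z) = abs z.
Proof. exact: normcN. Qed.

Lemma modulusD z w : abs (z + w) <= abs z + abs w.
Proof. exact: le_normcD. Qed.

Lemma modulusB z w : abs (z - w) = abs (w - z).
Proof. by rewrite -modulusN opprB. Qed.

Lemma modulus_leB z w : abs z - abs w <= abs (z - w).
Proof. by rewrite lerBlDr -{1}(subrK w z) modulusD. Qed.

Lemma modulusC r : abs (r%:C%C) = `|r|.
Proof. by rewrite /modulus /= expr0n addr0 sqrtr_sqr. Qed.

Lemma modulus_sum (I : Type) (s : seq I) (P : pred I) (F : I -> C) :
  abs (\sum_(i <- s | P i) F i) <= \sum_(i <- s | P i) abs (F i).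
Proof.
elim/big_rec2: _ => [|i y x _ le]; first by rewrite modulus0.
by apply: (le_trans (modulusD _ _)); rewrite lerD2l.
Qed.

Lemma ReD z w : complex.Re (z + w) = complex.Re z + complex.Re w.
Proof. by case: z w => [? ?] [? ?]. Qed.
Lemma ImD z w : complex.Im (z + w) = complex.Im z + complex.Im w.
Proof. by case: z w => [? ?] [? ?]. Qed.

Lemma modulus_sqr z : abs z ^+ 2 = complex.Re z ^+ 2 + complex.Im z ^+ 2.
Proof. by case: z => x y /=; rewrite sqr_sqrtr // addr_ge0 // sqr_ge0. Qed.

Lemma Re_modulus z : `|complex.Re z| <= abs z.
Proof.
rewrite -(@ler_pXn2r _ 2) ?nnegrE ?modulus_ge0 // modulus_sqr real_normK ?num_real //.
by rewrite lerDl sqr_ge0.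
Qed.

Lemma Im_modulus z : `|complex.Im z| <= abs z.
Proof.
rewrite -(@ler_pXn2r _ 2) ?nnegrE ?modulus_ge0 // modulus_sqr real_normK ?num_real //.
by rewrite lerDr sqr_ge0.
Qed.

Lemma modulus_ReIm z : abs z <= `|complex.Re z| + `|complex.Im z|.
Proof.
rewrite -(@ler_pXn2r _ 2) ?nnegrE ?modulus_ge0 ?addr_ge0 // modulus_sqr.
rewrite -(real_normK (num_real (complex.Re z))) -(real_normK (num_real (complex.Im z))).
rewrite sqrrD; have : 0 <= `|complex.Re z| * `|complex.Im z| by rewrite mulr_ge0.
lra.
Qed.

Lemma nbhsCP z (A : set C) :
  nbhs z A <-> exists2 e, 0 < e & forall w, abs (w - z) < e -> A w.
Proof.
split=> [/nbhs_ballP[e /= e0 eA]|[e e0 eA]].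
  exists (complex.Re e).
    by move: e0; rewrite ltcE /= => /andP[_].
  move=> w zw; apply: eA; rewrite /ball /= -/(`|_|) distrC normE.
  by rewrite ltcE /= zw andbT; move: e0; rewrite ltcE /= => /andP[].
apply/nbhs_ballP; exists (e%:C)%C => /=; first by rewrite ltcR.
move=> w; rewrite /ball /= distrC normE ltcR => zw; exact: eA.
Qed.

Lemma openCP (A : set C) :
  open A <-> forall z, A z -> exists2 e, 0 < e & forall w, abs (w - z) < e -> A w.
Proof.
rewrite openE; split=> H z Az; first by apply/nbhsCP; exact: H.
by apply/nbhsCP; exact: H.
Qed.

Lemma continuousCP (f : C -> C) z : {for z, continuous f} <->
  forall e, 0 < e -> exists2 d, 0 < d &
     forall w, abs (w - z) < d -> abs (f w - f z) < e.
Proof.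
split=> [cf e e0|H A /nbhsCP[e e0 eA]].
  have /cf/nbhsCP : nbhs (f z) [set w | abs (w - f z) < e].
    by apply/nbhsCP; exists e.
  by [].
have [d d0 dP] := H e e0; apply/nbhsCP; exists d => // w wd.
by apply: eA; apply: dP.
Qed.

Lemma continuous_modulus : continuous (abs : C -> R).
Proof.
move=> z A /nbhs_ballP[e /= e0 eA]; apply/nbhsCP; exists e => // w wz.
apply: eA; rewrite /ball /= ; apply: le_lt_trans wz; rewrite ler_norml.
have := modulus_leB w z; have := modulus_leB z w.
by rewrite (modulusB z w); lra.
Qed.

(** The form in which differentiability enters the proof of Goursat's lemma: the
    error is bounded by a real multiple of the modulus. *)
Lemma derivable_eps (f : C -> C) z : derivable f z 1 ->
  exists d, forall e, 0 < e -> exists2 r, 0 < r &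
    forall w, abs (w - z) < r -> abs (f w - f z - d * (w - z)) <= e * abs (w - z).
Proof.
move=> /cvg_ex[/= d /cvgrPdist_le fd]; exists d => e e0.
have e0' : (0 : R[i]) < (e%:C)%C by rewrite ltcR.
have := fd _ e0'; rewrite near_withinE => /nbhsCP[r r0 rP]; exists r => // w wz.
have [->|wz0] := eqVneq w z; first by rewrite !subrr mulr0 subr0 modulus0 mulr0.
have wz1 : w - z != 0 by rewrite subr_eq0.
have /(_ _) := rP (w - z); rewrite subr0 => /(_ wz wz1).
rewrite [_ *: 1]mulr1 subrK normE lecR => H.
rewrite (_ : f w - f z - _ = - ((d - (w - z)^-1 *: (f w - f z)) * (w - z))); last first.
  by rewrite [_ *: _]/(_ * _) mulrBl mulrAC mulVf // mul1r opprB.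
by rewrite modulusN modulusM ler_wpM2r // modulus_ge0.
Qed.

Lemma holo_cst (c z : C) : derivable (fun=> c : C) z 1.
Proof. exact: derivable_cst. Qed.

Lemma holo_id z : derivable (fun w : C => w) z 1.
Proof. exact: derivable_id. Qed.

Lemma holoD (f g : C -> C) z : derivable f z 1 -> derivable g z 1 ->
  derivable (fun w => f w + g w) z 1.
Proof. by move=> fz gz; exact: (derivableD fz gz). Qed.

Lemma holoB (f g : C -> C) z : derivable f z 1 -> derivable g z 1 ->
  derivable (fun w => f w - g w) z 1.
Proof. by move=> fz gz; exact: (derivableB fz gz). Qed.

Lemma holoM (f g : C -> C) z : derivable f z 1 -> derivable g z 1 ->
  derivable (fun w => f w * g w) z 1.
Proof. by move=> fz gz; exact: (derivableM fz gz). Qed.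

Lemma holoX (f : C -> C) z k : derivable f z 1 -> derivable (fun w => f w ^+ k) z 1.
Proof.
move=> fz; elim: k => [|k IH].
  by rewrite (_ : (fun w => _) = fun=> 1); [exact: holo_cst|apply/funext => w; rewrite expr0].
rewrite (_ : (fun w => _) = fun w => f w * f w ^+ k); first exact: holoM.
by apply/funext => w; rewrite exprS.
Qed.

Lemma holoV (f : C -> C) z : derivable f z 1 -> f z != 0 ->
  derivable (fun w => (f w)^-1) z 1.
Proof. by move=> fz fz0; exact: derivableV. Qed.

Lemma holo_comp (f g : C -> C) z : derivable f (g z) 1 -> derivable g z 1 ->
  derivable (fun w => f (g w)) z 1.
Proof.
move=> /derivable1_diffP fz /derivable1_diffP gz; apply/derivable1_diffP.
exact (differentiable_comp gz fz).
Qed.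

Lemma holo_sum n (f : 'I_n -> C -> C) z : (forall i, derivable (f i) z 1) ->
  derivable (fun w => \sum_i f i w) z 1.
Proof. by move=> /derivable_sum; rewrite fct_sumE. Qed.

End modulus.

(** * Integrals of complex functions over real segments *)

Section integral.
Variable R : realType.
Local Notation C := (R[i]^o).
Local Notation abs := (@modulus R).
Local Notation mu := (@lebesgue_measure R).
Local Notation Re := (@complex.Re R).
Local Notation Im := (@complex.Im R).
Implicit Types (g h : R -> C) (a b c d r e x y : R).

Lemma continuous_Re : continuous (Re : C -> R).
Proof.
move=> z A /nbhs_ballP[e /= e0 eA]; apply/nbhsCP; exists e => // w wz.
apply: eA; rewrite /ball /=; apply: le_lt_trans wz.
rewrite (_ : Re z - Re w = Re (z - w)); last by case: (z) (w) => [? ?] [? ?].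
by rewrite -modulusB; exact: Re_modulus.
Qed.

Lemma continuous_Im : continuous (Im : C -> R).
Proof.
move=> z A /nbhs_ballP[e /= e0 eA]; apply/nbhsCP; exists e => // w wz.
apply: eA; rewrite /ball /=; apply: le_lt_trans wz.
rewrite (_ : Im z - Im w = Im (z - w)); last by case: (z) (w) => [? ?] [? ?].
by rewrite -modulusB; exact: Im_modulus.
Qed.

Definition seg_cts g a b := forall x, a <= x <= b -> {for x, continuous g}.

Definition cint g a b : C :=
  (\int[mu]_(x in `[a, b]) Re (g x)) +i* (\int[mu]_(x in `[a, b]) Im (g x)).

Lemma continuous_pt_integrable (f : R -> R) a b :
  (forall x, a <= x <= b -> {for x, continuous f}) ->
  mu.-integrable `[a, b] (EFin \o f).
Proof.
move=> fc; apply: continuous_compact_integrable; first exact: segment_compact.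
apply: continuous_in_subspaceT => x; rewrite inE /= in_itv /=; exact: fc.
Qed.

Lemma cts_Re g a b : seg_cts g a b -> mu.-integrable `[a, b] (EFin \o (fun x => Re (g x))).
Proof.
move=> gc; apply: continuous_pt_integrable => x xab.
by apply: (@continuous_comp _ _ _ g Re); [exact: gc|exact: continuous_Re].
Qed.

Lemma cts_Im g a b : seg_cts g a b -> mu.-integrable `[a, b] (EFin \o (fun x => Im (g x))).
Proof.
move=> gc; apply: continuous_pt_integrable => x xab.
by apply: (@continuous_comp _ _ _ g Im); [exact: gc|exact: continuous_Im].
Qed.

Lemma eq_cint g h a b : (forall x, a <= x <= b -> g x = h x) ->
  cint g a b = cint h a b.
Proof.
by move=> gh; congr (_ +i* _)%C; apply: eq_Rintegral => x; rewrite inE /= in_itv /=;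
  move=> /gh ->.
Qed.

Lemma cintD g h a b : seg_cts g a b -> seg_cts h a b ->
  cint (fun x => g x + h x) a b = cint g a b + cint h a b.
Proof.
move=> gc hc; rewrite /cint [RHS]/GRing.add /=; congr (_ +i* _)%C.
- by rewrite -RintegralD ?cts_Re //; apply: eq_Rintegral => x _; rewrite ReD.
- by rewrite -RintegralD ?cts_Im //; apply: eq_Rintegral => x _; rewrite ImD.
Qed.

Lemma integrable_mulr (f : R -> R) (k a b : R) : mu.-integrable `[a, b] (EFin \o f) ->
  mu.-integrable `[a, b] (EFin \o (fun x => k * f x)).
Proof. by move=> fi; apply: eq_integrable (integrableZl _ k fi). Qed.

Lemma cintZ (k : C) g a b : seg_cts g a b ->
  cint (fun x => k * g x) a b = k * cint g a b.
Proof.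
move=> gc; case: k => u v; rewrite /cint [RHS]/GRing.mul /=; congr (_ +i* _)%C.
- rewrite -!RintegralZl ?cts_Re ?cts_Im // -RintegralB //; last 2 first.
  + by apply: integrable_mulr; exact: cts_Re.
  + by apply: integrable_mulr; exact: cts_Im.
  by apply: eq_Rintegral => x _; case: (g x).
- rewrite -!RintegralZl ?cts_Re ?cts_Im // -RintegralD //; last 2 first.
  + by apply: integrable_mulr; exact: cts_Im.
  + by apply: integrable_mulr; exact: cts_Re.
  by apply: eq_Rintegral => x _; case: (g x).
Qed.

Lemma Rintegral_chasles (f : R -> R) a b c : a <= b -> b <= c ->
  mu.-integrable `[a, c] (EFin \o f) ->
  \int[mu]_(x in `[a, c]) f x =
  \int[mu]_(x in `[a, b]) f x + \int[mu]_(x in `[b, c]) f x.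
Proof.
move=> ab bc fi.
have /= H := @Rintegral_itvB R f (BLeft a) (BRight c) b fi.
have -> : \int[mu]_(x in `[b, c]) f x = \int[mu]_(x in `]b, c]) f x.
  rewrite -Rintegral_itv_obnd_cbnd //; apply: integrableS fi => //.
  by apply: subset_itvr; rewrite bnd_simp.
by rewrite -H ?bnd_simp // addrC subrK.
Qed.

Lemma cint_chasles g a b c : a <= b -> b <= c -> seg_cts g a c ->
  cint g a c = cint g a b + cint g b c.
Proof.
move=> ab bc gc; rewrite /cint [RHS]/GRing.add /=; congr (_ +i* _)%C.
- by apply: Rintegral_chasles => //; exact: cts_Re.
- by apply: Rintegral_chasles => //; exact: cts_Im.
Qed.

Lemma lebesgue_segment a b : a <= b -> fine (mu `[a, b]) = b - a.
Proof.
move=> ab; rewrite lebesgue_measure_itv /= lte_fin.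
by case: ltgtP ab => // -> _; rewrite subrr.
Qed.

Lemma cint_cst (k : C) a b : a <= b -> cint (fun=> k) a b = k * (b - a)%:C%C.
Proof.
move=> ab; rewrite /cint; case: k => u v; rewrite !Rintegral_cst // lebesgue_segment //.
by rewrite [RHS]/GRing.mul /= !mulr0 subr0 add0r.
Qed.

Lemma Rintegral_bound (f : R -> R) a b (M : R) : a <= b ->
  mu.-integrable `[a, b] (EFin \o f) -> (forall x, a <= x <= b -> `|f x| <= M) ->
  `|\int[mu]_(x in `[a, b]) f x| <= M * (b - a).
Proof.
move=> ab fi fM; apply: (le_trans (le_normr_Rintegral _ fi)) => //.
rewrite -(lebesgue_segment ab) -Rintegral_cst //; apply: le_Rintegral => //.
- by apply: eq_integrable (integrable_abse fi).
- apply: continuous_pt_integrable => x _; exact: cvg_cst.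
Qed.

(** The factor 2 comes from bounding the real and imaginary parts separately.
    It is harmless: the maximum principle absorbs every constant by passing to
    powers. *)
Lemma cint_bound g a b (M : R) : a <= b -> seg_cts g a b ->
  (forall x, a <= x <= b -> abs (g x) <= M) -> abs (cint g a b) <= 2 * M * (b - a).
Proof.
move=> ab gc gM; apply: (le_trans (modulus_ReIm _)).
have H1 : `|\int[mu]_(x in `[a, b]) Re (g x)| <= M * (b - a).
  apply: Rintegral_bound => //; first exact: cts_Re.
  by move=> x /gM; apply: le_trans; exact: Re_modulus.
have H2 : `|\int[mu]_(x in `[a, b]) Im (g x)| <= M * (b - a).
  apply: Rintegral_bound => //; first exact: cts_Im.
  by move=> x /gM; apply: le_trans; exact: Im_modulus.
by rewrite /=; lra.
Qed.

End integral.

(** * Integrals over the boundary of a rectangle and Goursat's lemma *)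

Section goursat.
Variable R : realType.
Local Notation C := (R[i]^o).
Local Notation abs := (@modulus R).
Local Notation Re := (@complex.Re R).
Local Notation Im := (@complex.Im R).
Implicit Types (f g : C -> C) (a b c d r e x y : R).

Lemma continuous_ptB f g (z : C) : {for z, continuous f} ->
  {for z, continuous g} -> {for z, continuous (fun w => f w - g w)}.
Proof. by move=> fz gz; exact: (cvgB fz gz). Qed.

Lemma continuous_ptM f g (z : C) : {for z, continuous f} ->
  {for z, continuous g} -> {for z, continuous (fun w => f w * g w)}.
Proof. by move=> fz gz; exact: (cvgM fz gz). Qed.

Lemma continuous_hline c : continuous (fun x : R => (x +i* c) : C).
Proof.
move=> x A /nbhsCP[e e0 eA]; apply/nbhs_ballP; exists e => //= y xy; apply: eA.
rewrite (_ : _ - _ = (y - x)%:C :> C); last first.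
  by rewrite /GRing.add /GRing.opp /= subrr.
by rewrite modulusC distrC.
Qed.

Lemma continuous_vline c : continuous (fun y : R => (c +i* y) : C).
Proof.
move=> x A /nbhsCP[e e0 eA]; apply/nbhs_ballP; exists e => //= y xy; apply: eA.
apply: le_lt_trans (modulus_ReIm _) _.
rewrite (_ : _ - _ = (0 +i* (y - x)) :> C); last first.
  by rewrite /GRing.add /GRing.opp /= subrr.
by rewrite /= normr0 add0r distrC.
Qed.

Definition rect a b c d : set C :=
  [set z | a <= Re z <= b /\ c <= Im z <= d].

Definition rect_bd a b c d : set C :=
  [set z | rect a b c d z /\ [\/ Re z = a, Re z = b, Im z = c | Im z = d]].

Definition hseg_int f c a b := cint (fun x => f (x +i* c)) a b.
Definition vseg_int f a c d := cint (fun y => f (a +i* y)) c d.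

(** The sides are traversed counterclockwise. *)
Definition rect_int f a b c d : C :=
  hseg_int f c a b - hseg_int f d a b + 'i * (vseg_int f b c d - vseg_int f a c d).

Definition hcts f c a b := forall x, a <= x <= b -> {for (x +i* c) : C, continuous f}.
Definition vcts f a c d := forall y, c <= y <= d -> {for (a +i* y) : C, continuous f}.

Lemma hctsP f c a b : hcts f c a b -> seg_cts (fun x => f (x +i* c)) a b.
Proof.
move=> fc x xab; apply: (@continuous_comp _ _ _ (fun x => (x +i* c) : C) f).
  exact: continuous_hline.
exact: fc.
Qed.

Lemma vctsP f a c d : vcts f a c d -> seg_cts (fun y => f (a +i* y)) c d.
Proof.
move=> fc y ycd; apply: (@continuous_comp _ _ _ (fun y => (a +i* y) : C) f).
  exact: continuous_vline.
exact: fc.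
Qed.

(** The integrand is allowed to be singular inside the rectangle, hence
    continuity is asked for on the four sides only. *)
Definition rcts f a b c d :=
  [/\ hcts f c a b, hcts f d a b, vcts f a c d & vcts f b c d].

Lemma rctsP f a b c d : a <= b -> c <= d ->
  (forall z, rect_bd a b c d z -> {for z, continuous f}) -> rcts f a b c d.
Proof.
move=> ab cd H; split => [x xab|x xab|y ycd|y ycd]; apply: H; split.
- by split => //=; rewrite lexx.
- by constructor 3.
- by split => //=; rewrite lexx cd.
- by constructor 4.
- by split => //=; rewrite lexx ab.
- by constructor 1.
- by split => //=; rewrite lexx ab.
- by constructor 2.
Qed.

Lemma eq_rect_int f g a b c d : a <= b -> c <= d ->
  (forall z, rect_bd a b c d z -> f z = g z) -> rect_int f a b c d = rect_int g a b c d.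
Proof.
move=> ab cd fg; rewrite /rect_int.
congr (_ - _ + _ * (_ - _)); apply: eq_cint => t t01; apply: fg; split.
- by split => //=; rewrite lexx.
- by constructor 3.
- by split => //=; rewrite lexx cd.
- by constructor 4.
- by split => //=; rewrite lexx ab.
- by constructor 2.
- by split => //=; rewrite lexx ab.
- by constructor 1.
Qed.

Lemma rect_intD f g a b c d : rcts f a b c d -> rcts g a b c d ->
  rect_int (fun z => f z + g z) a b c d = rect_int f a b c d + rect_int g a b c d.
Proof.
move=> [f1 f2 f3 f4] [g1 g2 g3 g4]; rewrite /rect_int /hseg_int /vseg_int.
by rewrite !cintD; [ring|exact: vctsP..|exact: hctsP|exact: hctsP|exact: hctsP|exact: hctsP].
Qed.

Lemma rect_intZ (k : C) f a b c d : rcts f a b c d ->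
  rect_int (fun z => k * f z) a b c d = k * rect_int f a b c d.
Proof.
move=> [f1 f2 f3 f4]; rewrite /rect_int /hseg_int /vseg_int.
by rewrite !cintZ; [ring|exact: vctsP..|exact: hctsP|exact: hctsP].
Qed.

(** On opposite sides an affine function differs by a constant, so that only
    integrals of constants have to be computed. *)
Lemma rect_int_affine (k l : C) a b c d : a <= b -> c <= d ->
  rect_int (fun z => k + l * z) a b c d = 0.
Proof.
move=> ab cd; rewrite /rect_int /hseg_int /vseg_int.
have cc (h : R -> C) p q : continuous h -> seg_cts h p q by move=> hc x _; exact: hc.
have ch p : continuous (fun x : R => (x +i* p) : C) by exact: continuous_hline.
have cv p : continuous (fun x : R => (p +i* x) : C) by exact: continuous_vline.
have E (h : R -> C) p q : seg_cts h p q ->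
    cint (fun x => k + l * h x) p q = cint (fun=> k) p q + l * cint h p q.
  move=> hc.
  have kc : seg_cts (fun=> k) p q by apply: cc => x; exact: cvg_cst.
  have lc : seg_cts (fun x => l * h x) p q.
    by move=> x /hc hx; apply: cvgM; [exact: cvg_cst|exact: hx].
  by rewrite (cintD kc lc) (cintZ l hc).
rewrite !E; try exact: cc.
have Dh p q : a <= b ->
  cint (fun x => x +i* p) a b = cint (fun x => x +i* q) a b + (0 +i* (p - q)) * (b - a)%:C :> C.
  move=> _; rewrite -cint_cst // -cintD; [|exact: cc|by apply: cc => x; exact: cvg_cst].
  by apply: eq_cint => x _; rewrite /GRing.add /= addr0 addrC subrK.
have Dv p q : c <= d ->
  cint (fun x => p +i* x) c d = cint (fun x => q +i* x) c d + (p - q)%:C * (d - c)%:C :> C.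
  move=> _; rewrite -cint_cst // -cintD; [|exact: cc|by apply: cc => x; exact: cvg_cst].
  by apply: eq_cint => x _; rewrite /GRing.add /= addr0 addrC subrK.
rewrite (Dh c d) // (Dv b a) //.
have -> : (0 +i* (c - d) : C) = - ('i * (d - c)%:C).
  by apply/eqP; rewrite eq_complex /=; apply/andP; split; apply/eqP; ring.
ring.
Qed.

Lemma rect_int_bound f a b c d (M : R) : a <= b -> c <= d -> rcts f a b c d ->
  (forall z, rect_bd a b c d z -> abs (f z) <= M) ->
  abs (rect_int f a b c d) <= 4 * M * ((b - a) + (d - c)).
Proof.
move=> ab cd [f1 f2 f3 f4] fM; rewrite /rect_int /hseg_int /vseg_int.
have fM1 x : a <= x <= b -> abs (f (x +i* c)) <= M.
  by move=> xab; apply: fM; split; [split => //=; rewrite lexx|constructor 3].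
have fM2 x : a <= x <= b -> abs (f (x +i* d)) <= M.
  by move=> xab; apply: fM; split; [split => //=; rewrite lexx cd|constructor 4].
have fM3 y : c <= y <= d -> abs (f (a +i* y)) <= M.
  by move=> xab; apply: fM; split; [split => //=; rewrite lexx ab|constructor 1].
have fM4 y : c <= y <= d -> abs (f (b +i* y)) <= M.
  by move=> xab; apply: fM; split; [split => //=; rewrite lexx ab|constructor 2].
have H1 := cint_bound ab (hctsP f1) fM1.
have H2 := cint_bound ab (hctsP f2) fM2.
have H3 := cint_bound cd (vctsP f3) fM3.
have H4 := cint_bound cd (vctsP f4) fM4.
apply: (le_trans (modulusD _ _)); rewrite modulusM.
have -> : abs 'i = 1 by rewrite /modulus /= expr0n expr1n add0r sqrtr1.
have D1 := modulusD (cint (fun x => f (x +i* c)) a b) (- cint (fun x => f (x +i* d)) a b).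
have D2 := modulusD (cint (fun x => f (b +i* x)) c d) (- cint (fun x => f (a +i* x)) c d).
rewrite !modulusN in D1 D2; lra.
Qed.

Lemma rect_int_vcut f a b e c d : a <= b -> b <= e ->
  hcts f c a e -> hcts f d a e ->
  rect_int f a e c d = rect_int f a b c d + rect_int f b e c d.
Proof.
move=> ab be fc fd; rewrite /rect_int /hseg_int.
rewrite (cint_chasles ab be); last exact: hctsP.
rewrite (cint_chasles ab be); last exact: hctsP.
ring.
Qed.

Lemma rect_int_hcut f a b c d e : c <= d -> d <= e ->
  vcts f a c e -> vcts f b c e ->
  rect_int f a b c e = rect_int f a b c d + rect_int f a b d e.
Proof.
move=> ab be fc fd; rewrite /rect_int /vseg_int.
rewrite (cint_chasles ab be); last exact: vctsP.
rewrite (cint_chasles ab be); last exact: vctsP.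
ring.
Qed.

Lemma nested_segments (u w : nat -> R) :
  (forall k, 0 <= w k) -> (forall k, u k <= u k.+1) ->
  (forall k, u k.+1 + w k.+1 <= u k + w k) ->
  exists x, forall k, u k <= x <= u k + w k.
Proof.
move=> w0 uS wS.
have um : {homo u : i j / (i <= j)%N >-> i <= j}.
  by apply: homo_leq => //; exact: le_trans.
have wm : {homo (fun k => u k + w k) : i j / (i <= j)%N >-> j <= i}.
  apply: (@homo_leq _ _ (fun x y => y <= x)) => //.
  by move=> x y z yx xz; exact: le_trans xz yx.
have uw j k : u j <= u k + w k.
  have [/um h|/ltnW/wm h] := leqP j k.
    by rewrite (le_trans h) // lerDl.
  by rewrite (le_trans _ h) // lerDl.
exists (sup (range u)) => k; apply/andP; split.
  apply: ub_le_sup; last by exists k.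
  by exists (u 0%N + w 0%N) => _ [j _ <-].
by apply: ge_sup; [exists (u 0%N); exists 0%N|move=> _ [j _ <-]].
Qed.

Lemma derivable_continuous f (z : C) : derivable f z 1 -> {for z, continuous f}.
Proof. by move=> fz; exact/differentiable_continuous/derivable1_diffP. Qed.

Lemma rcts_rect f a b c d a' b' c' d' : a' <= b' -> c' <= d' ->
  a <= a' -> b' <= b -> c <= c' -> d' <= d ->
  (forall z, rect a b c d z -> {for z, continuous f}) -> rcts f a' b' c' d'.
Proof.
move=> ab' cd' aa bb cc dd fc; apply: rctsP => // z [[zab zcd] _]; apply: fc.
by split; lra.
Qed.

(** The bisection step of Goursat's lemma: the four quarters add up to the
    whole, so that one of them carries a quarter of the modulus. *)
Lemma rect_int_quarter f a c (w h m : R) : 0 <= w -> 0 <= h ->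
  (forall z, rect a (a + w) c (c + h) z -> {for z, continuous f}) ->
  4 * m <= abs (rect_int f a (a + w) c (c + h)) ->
  exists p : C, [/\ a <= Re p, Re p + w / 2 <= a + w, c <= Im p, Im p + h / 2 <= c + h
   & m <= abs (rect_int f (Re p) (Re p + w / 2) (Im p) (Im p + h / 2))].
Proof.
move=> w0 h0 fc mle.
pose I x y := abs (rect_int f x (x + w / 2) y (y + h / 2)).
have hc y : c <= y <= c + h -> hcts f y a (a + w).
  by move=> yc x xa; apply: fc; split.
have vc x y y' : a <= x <= a + w -> c <= y -> y' <= c + h -> vcts f x y y'.
  by move=> xa yc yc' t ty; apply: fc; split => //=; lra.
have : 4 * m <= I a c + I a (c + h / 2) + I (a + w / 2) c + I (a + w / 2) (c + h / 2).
  apply: (le_trans mle).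
  rewrite (@rect_int_vcut _ _ (a + w / 2)); [|lra|lra|apply: hc; lra|apply: hc; lra].
  rewrite (@rect_int_hcut _ a (a + w / 2) c (c + h / 2)); [|lra|lra|apply: vc; lra|apply: vc; lra].
  rewrite (@rect_int_hcut _ (a + w / 2) (a + w) c (c + h / 2)); [|lra|lra|apply: vc; lra|apply: vc; lra].
  rewrite /I (_ : a + w / 2 + w / 2 = a + w); last by lra.
  rewrite (_ : c + h / 2 + h / 2 = c + h); last by lra.
  set A := rect_int _ _ _ _ _; set B := rect_int _ _ _ _ _; set A' := rect_int _ _ _ _ _.
  set B' := rect_int _ _ _ _ _.
  rewrite -[leRHS]addrA; apply: (le_trans (modulusD _ _)); apply: lerD; exact: modulusD.
have q (x y : R) : a <= x -> x + w / 2 <= a + w -> c <= y -> y + h / 2 <= c + h -> m <= I x y ->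
  exists p : C, [/\ a <= Re p, Re p + w / 2 <= a + w, c <= Im p, Im p + h / 2 <= c + h
   & m <= abs (rect_int f (Re p) (Re p + w / 2) (Im p) (Im p + h / 2))].
  by move=> *; exists (x +i* y).
have [h1 _|h1] := leP m (I a c); first by apply: (q _ _ _ _ _ _ h1); clear -w0 h0; lra.
have [h2 _|h2] := leP m (I a (c + h / 2)); first by apply: (q _ _ _ _ _ _ h2); clear -w0 h0; lra.
have [h3 _|h3] := leP m (I (a + w / 2) c); first by apply: (q _ _ _ _ _ _ h3); clear -w0 h0; lra.
have [h4 _|h4] := leP m (I (a + w / 2) (c + h / 2)); first by apply: (q _ _ _ _ _ _ h4); clear -w0 h0; lra.
move: h1 h2 h3 h4; move: (I a c) (I a (c + h / 2)) (I (a + w / 2) c) (I (a + w / 2) (c + h / 2)).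
by clear=> u v u' v'; lra.
Qed.

Lemma half_pow_lt (s r : R) : 0 < r -> exists k, s / 2 ^+ k < r.
Proof.
move=> r0; have [s0|s0] := leP s 0.
  by exists 0%N; rewrite expr0 divr1; lra.
have := archi_boundP (ltW (divr_gt0 s0 r0)); set k := Num.bound _ => hk.
exists k; rewrite ltr_pdivrMr ?exprn_gt0 // mulrC -ltr_pdivrMr //.
by apply: lt_le_trans hk _; rewrite -natrX ler_nat ltnW // ltn_expl.
Qed.

(** Repeated bisection finds rectangles that shrink to a point z while their
    integrals decrease no faster than 4^-k.  Near z the function is affine up to an
    error e |v - z|, and that error contributes at most a multiple of e 4^-k. *)
Theorem goursat f a b c d : a <= b -> c <= d ->
  (forall z, rect a b c d z -> derivable f z 1) -> rect_int f a b c d = 0.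
Proof.
move=> ab cd fd; apply/eqP; rewrite -modulus_eq0; apply/negPn; rewrite modulus_eq0 -modulus_gt0.
set m := abs _; apply/negP => m0.
pose w := b - a; pose h := d - c.
have w0 : 0 <= w by rewrite subr_ge0.
have h0 : 0 <= h by rewrite subr_ge0.
have pow0 k : 0 < 2 ^+ k :> R by exact: exprn_gt0.
have wk0 k : 0 <= w / 2 ^+ k by rewrite divr_ge0 // ltW.
have hk0 k : 0 <= h / 2 ^+ k by rewrite divr_ge0 // ltW.
have fc z : rect a b c d z -> {for z, continuous f}.
  by move=> /fd; exact: derivable_continuous.
pose inside k (p : C) := [/\ a <= Re p, Re p + w / 2 ^+ k <= b, c <= Im p & Im p + h / 2 ^+ k <= d].
pose good k (p : C) := inside k p /\
   m / 4 ^+ k <= abs (rect_int f (Re p) (Re p + w / 2 ^+ k) (Im p) (Im p + h / 2 ^+ k)).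
have /choice[F FP] : forall kp : nat * C, exists p : C, good kp.1 kp.2 ->
   good kp.1.+1 p /\ [/\ Re kp.2 <= Re p, Re p + w / 2 ^+ kp.1.+1 <= Re kp.2 + w / 2 ^+ kp.1,
     Im kp.2 <= Im p & Im p + h / 2 ^+ kp.1.+1 <= Im kp.2 + h / 2 ^+ kp.1].
  move=> [k p] /=; have [[[i1 i2 i3 i4] gp]|ngp] := pselect (good k p); last by exists p.
  have wS : w / 2 ^+ k / 2 = w / 2 ^+ k.+1.
    by rewrite exprS; field; rewrite lt0r_neq0.
  have hS : h / 2 ^+ k / 2 = h / 2 ^+ k.+1.
    by rewrite exprS; field; rewrite lt0r_neq0.
  have mS : 4 * (m / 4 ^+ k.+1) = m / 4 ^+ k.
    by rewrite exprS; field; rewrite expf_neq0 //.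
  have rc z : rect (Re p) (Re p + w / 2 ^+ k) (Im p) (Im p + h / 2 ^+ k) z ->
      {for z, continuous f}.
    by move=> [z1 z2]; apply: fc; split; lra.
  rewrite -mS in gp.
  have [q [q1 q2 q3 q4 q5]] := rect_int_quarter (wk0 k) (hk0 k) rc gp.
  rewrite wS hS in q2 q4 q5; exists q => _; split; last by split.
  by split => //; clear -i1 i2 i3 i4 q1 q2 q3 q4; split; lra.
pose p := fix p k : C := if k is k'.+1 then F (k', p k') else (a +i* c).
have gp k : good k (p k).
  elim: k => [|k IH]; last by have [] := FP (k, p k) IH.
  rewrite /good /inside /= expr0 !divr1 (_ : a + w = b); last by rewrite /w; lra.
  by rewrite (_ : c + h = d) //; rewrite /h; lra.
have st k := (FP (k, p k) (gp k)).2.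
have [x xP] := @nested_segments (Re \o p) (fun k => w / 2 ^+ k) wk0
  (fun k => let: And4 s _ _ _ := st k in s) (fun k => let: And4 _ s _ _ := st k in s).
have [y yP] := @nested_segments (Im \o p) (fun k => h / 2 ^+ k) hk0
  (fun k => let: And4 _ _ s _ := st k in s) (fun k => let: And4 _ _ _ s := st k in s).
pose z : C := x +i* y.
have /fd/derivable_eps[D DP] : rect a b c d z.
  have := xP 0%N; have := yP 0%N; rewrite /= expr0 !divr1 /w /h => ? ?.
  by split => /=; lra.
(* beats the constant 4 (w + h)^2 of the final estimate, also when w = h = 0 *)
pose e := m / (8 * (w + h + 1) ^+ 2).
have e0 : 0 < e by rewrite divr_gt0 // mulr_gt0 // exprn_gt0 //; lra.
have [r r0 rP] := DP e e0.
have [k kP] := half_pow_lt (w + h) r0.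
have [[i1 i2 i3 i4]] := gp k; apply/negP; rewrite -ltNge.
set a' := Re (p k); set c' := Im (p k); set b' := _ + _; set d' := c' + _.
have ab' : a' <= b' by rewrite lerDl.
have cd' : c' <= d' by rewrite lerDl.
have close v : rect a' b' c' d' v -> abs (v - z) <= (w + h) / 2 ^+ k.
  move=> [v1 v2]; apply: (le_trans (modulus_ReIm _)).
  have -> : Re (v - z) = Re v - x by case: (v).
  have -> : Im (v - z) = Im v - y by case: (v).
  have := xP k; have := yP k; rewrite /= -/a' -/c' => yk xk.
  have hx : `|Re v - x| <= w / 2 ^+ k.
    by rewrite ler_norml; clear -v1 xk; rewrite /b' in v1; lra.
  have hy : `|Im v - y| <= h / 2 ^+ k.
    by rewrite ler_norml; clear -v2 yk; rewrite /d' in v2; lra.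
  by rewrite mulrDl; exact: lerD hx hy.
have cf : rcts f a' b' c' d' := rcts_rect ab' cd' i1 i2 i3 i4 fc.
pose rho (v : C) := f v - (f z - D * z + D * v).
have caff : continuous (fun v : C => f z - D * z + D * v).
  move=> v; apply: derivable_continuous; apply: derivableD; first exact: derivable_cst.
  by apply: derivableM; [exact: derivable_cst|exact: derivable_id].
have crho : rcts rho a' b' c' d'.
  apply: (rcts_rect ab' cd' i1 i2 i3 i4) => v vr.
  by apply: continuous_ptB; [exact: fc|exact: caff].
have -> : rect_int f a' b' c' d' = rect_int rho a' b' c' d'.
  have crho' : rcts (fun v : C => f z - D * z + D * v) a' b' c' d'.
    by apply: rctsP => [||v _]; [exact: ab'|exact: cd'|exact: caff].
  have := rect_intD crho' crho; rewrite (rect_int_affine _ _ ab' cd') add0r => <-.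
  by apply: eq_rect_int => [||v _]; [exact: ab'|exact: cd'|rewrite /rho addrC subrK].
have rho_le v : rect_bd a' b' c' d' v -> abs (rho v) <= e * ((w + h) / 2 ^+ k).
  move=> [vr _]; have vz := close v vr.
  have := rP v (le_lt_trans vz kP).
  rewrite (_ : f v - f z - _ = rho v); last by rewrite /rho; ring.
  by move=> /le_trans; apply; rewrite ler_pM2l.
apply: (le_lt_trans (rect_int_bound ab' cd' crho rho_le)).
have -> : b' - a' + (d' - c') = (w + h) / 2 ^+ k by rewrite /b' /d'; ring.
have -> : 4 * (e * ((w + h) / 2 ^+ k)) * ((w + h) / 2 ^+ k) =
   (m / 4 ^+ k) * ((w + h) ^+ 2 / (2 * (w + h + 1) ^+ 2)).
  rewrite (_ : 4 ^+ k = 2 ^+ k * 2 ^+ k); last first.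
    by rewrite -exprMn -natrM.
  rewrite /e; field; apply/andP; split; apply: lt0r_neq0; last exact: pow0.
  by clear -w0 h0; lra.
rewrite -[ltRHS]mulr1 ltr_pM2l; last by rewrite divr_gt0 // exprn_gt0.
clear -w0 h0; rewrite ltr_pdivrMr ?mul1r; last by rewrite mulr_gt0 // exprn_gt0 //; lra.
nra.
Qed.

End goursat.

(** * Isolated singularities inside a rectangle *)

Section cauchy.
Variable R : realType.
Local Notation C := (R[i]^o).
Local Notation abs := (@modulus R).
Local Notation Re := (@complex.Re R).
Local Notation Im := (@complex.Im R).
Local Notation mu := (@lebesgue_measure R).
Implicit Types (f g : C -> C) (a b c d r e x y s : R) (z w : C).

Definition square_int f z s := rect_int f (Re z - s) (Re z + s) (Im z - s) (Im z + s).

(** Two vertical and two horizontal cuts leave the small square around z and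
    four rectangles on which Goursat's lemma applies. *)
Lemma rect_int_isolate f a b c d z s : 0 < s ->
  a < Re z - s -> Re z + s < b -> c < Im z - s -> Im z + s < d ->
  (forall w, rect a b c d w -> w != z -> derivable f w 1) ->
  rect_int f a b c d = square_int f z s.
Proof.
move=> s0 az zb cz zd fd.
have fc w : rect a b c d w -> w != z -> {for w, continuous f}.
  by move=> wr wz; apply: derivable_continuous; exact: fd.
have neqR w : Re w < Re z \/ Re z < Re w -> w != z.
  by case=> h; apply/eqP => wz; move: h; rewrite wz ltxx.
have neqI w : Im w < Im z \/ Im z < Im w -> w != z.
  by case=> h; apply/eqP => wz; move: h; rewrite wz ltxx.
have hc y a' b' : c <= y <= d -> y < Im z \/ Im z < y -> a <= a' -> b' <= b ->
    hcts f y a' b'.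
  move=> yc yz aa bb x xab; apply: fc; last exact: neqI.
  by split => /=; lra.
have vc x c' d' : a <= x <= b -> x < Re z \/ Re z < x -> c <= c' -> d' <= d ->
    vcts f x c' d'.
  move=> xa xz cc dd y yab; apply: fc; last exact: neqR.
  by split => /=; lra.
have Gl : rect_int f a (Re z - s) c d = 0.
  apply: goursat => [||w [w1 w2]]; [lra|lra|apply: fd; last by apply: neqR; left; lra].
  by split; lra.
have Gr : rect_int f (Re z + s) b c d = 0.
  apply: goursat => [||w [w1 w2]]; [lra|lra|apply: fd; last by apply: neqR; right; lra].
  by split; lra.
have Gb : rect_int f (Re z - s) (Re z + s) c (Im z - s) = 0.
  apply: goursat => [||w [w1 w2]]; [lra|lra|apply: fd; last by apply: neqI; left; lra].
  by split; lra.
have Gt : rect_int f (Re z - s) (Re z + s) (Im z + s) d = 0.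
  apply: goursat => [||w [w1 w2]]; [lra|lra|apply: fd; last by apply: neqI; right; lra].
  by split; lra.
have -> : rect_int f a b c d = rect_int f a (Re z - s) c d + rect_int f (Re z - s) b c d.
  by apply: rect_int_vcut; [lra|lra|apply: hc; lra|apply: hc; lra].
have -> : rect_int f (Re z - s) b c d = rect_int f (Re z - s) (Re z + s) c d + rect_int f (Re z + s) b c d.
  by apply: rect_int_vcut; [lra|lra|apply: hc; lra|apply: hc; lra].
have -> : rect_int f (Re z - s) (Re z + s) c d = rect_int f (Re z - s) (Re z + s) c (Im z - s) +
    rect_int f (Re z - s) (Re z + s) (Im z - s) d.
  by apply: rect_int_hcut; [lra|lra|apply: vc; lra|apply: vc; lra].
have -> : rect_int f (Re z - s) (Re z + s) (Im z - s) d = square_int f z s +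
    rect_int f (Re z - s) (Re z + s) (Im z + s) d.
  by apply: rect_int_hcut; [lra|lra|apply: vc; lra|apply: vc; lra].
by rewrite Gl Gr Gb Gt !add0r !addr0.
Qed.

(** After shrinking to a square of side 2 s around z, the integral is O(s). *)
Lemma rect_int_bounded_singularity f a b c d z (M : R) :
  a < Re z < b -> c < Im z < d ->
  (forall w, rect a b c d w -> w != z -> derivable f w 1) ->
  (forall w, rect a b c d w -> w != z -> abs (f w) <= M) ->
  rect_int f a b c d = 0.
Proof.
move=> zab zcd fd fM; apply/eqP; rewrite -modulus_eq0; apply/negPn.
rewrite modulus_eq0 -modulus_gt0; apply/negP => I0.
set I := abs _ in I0.
pose s1 := Num.min (Num.min (Re z - a) (b - Re z)) (Num.min (Im z - c) (d - Im z)).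
have s10 : 0 < s1 by rewrite !lt_min; apply/andP; split; apply/andP; split; lra.
have M0 : 0 <= M.
  have aRC : rect a b c d (a +i* Im z) by split => /=; lra.
  apply: le_trans (fM _ aRC _); first exact: modulus_ge0.
  by apply/negP => /eqP/(congr1 Re) /=; lra.
have [s [s0 ss1 sI]] : exists s, [/\ 0 < s, s < s1 & 16 * (M + 1) * s < I].
  exists (Num.min (s1 / 2) (I / (32 * (M + 1)))).
  have M1 : 0 < 32 * (M + 1) by lra.
  rewrite lt_min !divr_gt0 //; split => //.
    by rewrite gt_min; apply/orP; left; lra.
  rewrite minElt; case: ifP => [h|_].
    rewrite ltr_pdivlMr // in h; lra.
  by rewrite mulrA ltr_pdivrMr //; nra.
have : s < s1 by [].
rewrite !lt_min => /andP[/andP[sa sb] /andP[sc sd]].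
move: sI; apply/negP; rewrite -leNgt.
rewrite /I (@rect_int_isolate f a b c d z s) //; try lra.
have bd w : rect_bd (Re z - s) (Re z + s) (Im z - s) (Im z + s) w ->
    rect a b c d w /\ w != z.
  move=> [[w1 w2] w3]; split; first by split; lra.
  by apply/negP => /eqP wz; move: w3; rewrite wz => -[]; lra.
have B : abs (square_int f z s) <=
    4 * M * ((Re z + s - (Re z - s)) + (Im z + s - (Im z - s))).
  apply: rect_int_bound => [|||w /bd[wr wz]]; [lra|lra| |exact: fM].
  apply: rctsP => [||w /bd[wr wz]]; [lra|lra|].
  by apply: derivable_continuous; exact: fd.
by apply: (le_trans B); clear -M0 s0; nra.
Qed.

Lemma Rintegral_translate (G : R -> R) a b t : a <= b ->
  (forall x, a + t <= x <= b + t -> {for x, continuous G}) ->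
  \int[mu]_(x in `[a + t, b + t]) G x = \int[mu]_(x in `[a, b]) G (x + t).
Proof.
move=> ab Gc; rewrite /Rintegral; congr fine.
pose F := fun x : R => x + t.
have dF x : is_derive x (1 : R) F 1.
  rewrite /F -[X in is_derive _ _ _ X]addr0.
  by apply: is_deriveD.
have dF1 : derive1 F = cst 1 by apply/funext => x; rewrite derive1E; exact: derive_val.
rewrite -[a + t]/(F a) -[b + t]/(F b).
rewrite (@integration_by_substitution_increasing _ F G a b) //.
- by apply: eq_integral => x _; rewrite dF1 /= /F /= [_ * _]mulr1.
- by move=> x y _ _ xy; rewrite /F ltrD2r.
- by rewrite dF1 => x _; exact: cvg_cst.
- by rewrite dF1; exact: is_cvg_cst.
- by rewrite dF1; exact: is_cvg_cst.
- split.
  + by move=> x _; apply: ex_derive.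
  + apply: cvg_at_right_filter; apply: differentiable_continuous; exact/derivable1_diffP/ex_derive.
  + apply: cvg_at_left_filter; apply: differentiable_continuous; exact/derivable1_diffP/ex_derive.
- apply: continuous_in_subspaceT => x; rewrite inE /= in_itv /=; exact: Gc.
Qed.

Lemma cint_translate (g : R -> C) a b t : a <= b -> seg_cts g (a + t) (b + t) ->
  cint g (a + t) (b + t) = cint (fun x => g (x + t)) a b.
Proof.
move=> ab gc; rewrite /cint; congr (_ +i* _); apply: Rintegral_translate => // x xab.
- by apply: (@continuous_comp _ _ _ g Re); [exact: gc|exact: continuous_Re].
- by apply: (@continuous_comp _ _ _ g Im); [exact: gc|exact: continuous_Im].
Qed.

Lemma square_int_translate f z s : 0 <= s ->
  (forall w, rect_bd (Re z - s) (Re z + s) (Im z - s) (Im z + s) w ->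
    {for w, continuous f}) ->
  square_int f z s = square_int (fun w => f (w + z)) 0 s.
Proof.
move=> s0 fc.
have [|||h1 h2 v1 v2] := @rctsP _ f (Re z - s) (Re z + s) (Im z - s) (Im z + s); [lra|lra|exact: fc|].
have E p q : (p +i* q + z : C) = ((p + Re z) +i* (q + Im z)) by case: (z).
have ss : - s <= s by clear -s0; lra.
have := vctsP v2; have := vctsP v1; have := hctsP h2; have := hctsP h1.
have sh u : u - s = - s + u by rewrite addrC.
have sh' u : u + s = s + u by rewrite addrC.
rewrite /square_int /rect_int /hseg_int /vseg_int /= !add0r !sh !sh' => c1 c2 c3 c4.
rewrite (cint_translate ss c1) (cint_translate ss c2).
rewrite (cint_translate ss c3) (cint_translate ss c4).
by congr (_ - _ + _ * (_ - _)); apply: eq_cint => x _; rewrite E.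
Qed.

(** This is 2 i pi; the value is not computed, since only its independence of
    the square and its being nonzero matter. *)
Definition cauchy_cst s : C := square_int (fun w => w^-1) 0 s.

Lemma derivable_inv z : z != 0 -> derivable (fun w : C => w^-1) z 1.
Proof. by move=> z0; apply: (@derivableV _ _ id) => //; exact: derivable_id. Qed.

(** Opposite sides are paired: both pairs contribute the same integrand
    2 i s / (t^2 + s^2). *)
Lemma cauchy_cstE s : 0 < s ->
  cauchy_cst s = cint (fun t => 0 +i* (4 * s / (t ^+ 2 + s ^+ 2))) (- s) s.
Proof.
move=> s0; have ss : - s <= s by lra.
have hs : rcts (fun w : C => w^-1) (- s) s (- s) s.
  apply: rctsP => [||w [[w1 w2] w3]]; [lra|lra|].
  apply/derivable_continuous/derivable_inv.
  by apply/negP => /eqP w0; move: w1 w2 w3; rewrite w0 /= => _ _ []; lra.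
have [/hctsP c1 /hctsP c2 /vctsP c3 /vctsP c4] := hs.
pose g1 t : C := (t +i* (- s))^-1; pose g2 t : C := (t +i* s)^-1.
pose g3 t : C := (s +i* t)^-1; pose g4 t : C := ((- s) +i* t)^-1.
have cZ (k : C) (g : R -> C) : seg_cts g (- s) s -> seg_cts (fun x => k * g x) (- s) s.
  by move=> gc x xs; apply: cvgM; [exact: cvg_cst|exact: gc].
have cD (g h : R -> C) : seg_cts g (- s) s -> seg_cts h (- s) s -> seg_cts (fun x => g x + h x) (- s) s.
  by move=> gc hc x xs; exact: (cvgD (gc _ xs) (hc _ xs)).
have D (g h : R -> C) : seg_cts g (- s) s -> seg_cts h (- s) s ->
    cint g (- s) s - cint h (- s) s = cint (fun x => g x + -1 * h x) (- s) s.
  by move=> gc hc; rewrite (cintD gc (cZ (-1) _ hc)) (cintZ (-1) hc) mulN1r.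
have E : cauchy_cst s = cint g1 (- s) s - cint g2 (- s) s +
    'i * (cint g3 (- s) s - cint g4 (- s) s).
  by rewrite /cauchy_cst /square_int /rect_int /hseg_int /vseg_int /= !add0r.
rewrite E (D _ _ c1 c2) (D _ _ c4 c3) -(cintZ 'i (cD _ _ c4 (cZ (-1) _ c3))).
rewrite -(cintD (cD _ _ c1 (cZ (-1) _ c2)) (cZ 'i _ (cD _ _ c4 (cZ (-1) _ c3)))).
apply: eq_cint => x _.
have /lt0r_neq0 x0 : 0 < x ^+ 2 + s ^+ 2 by rewrite ltr_wpDl ?sqr_ge0 // exprn_gt0.
have x0' : s ^+ 2 + x ^+ 2 != 0 by rewrite addrC.
apply/eqP; rewrite eq_complex /= !sqrrN; apply/andP; split; apply/eqP; field;
  first [exact: x0 | exact: x0' | by apply/andP].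
Qed.

Lemma cauchy_cst_neq0 s : 0 < s -> cauchy_cst s != 0.
Proof.
move=> s0; rewrite cauchy_cstE //; apply/negP => /eqP/(congr1 Im).
move=> /= I0.
(* on [-s, s] the integrand is at least 4 s / (2 s^2) *)
have : \int[mu]_(x in `[- s, s]) (2 / s) <= \int[mu]_(x in `[- s, s]) (4 * s / (x ^+ 2 + s ^+ 2)).
  apply: le_Rintegral => //.
  - by apply: continuous_pt_integrable => x _; exact: cvg_cst.
  - apply: continuous_pt_integrable => x _; apply: cvgM; first exact: cvg_cst.
    have xs : x ^+ 2 + s ^+ 2 != 0.
      by rewrite lt0r_neq0 // ltr_wpDl ?sqr_ge0 // exprn_gt0.
    apply: cvgV; first exact: xs.
    exact: (cvgD (@exprn_continuous R 2 x) (cvg_cst (s ^+ 2))).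
  - move=> x /=; rewrite in_itv /= => /andP[xs sx].
    have sq0 : 0 < x ^+ 2 + s ^+ 2 by rewrite ltr_wpDl ?sqr_ge0 // exprn_gt0.
    rewrite ler_pdivlMr // mulrAC ler_pdivrMr //.
    have : x ^+ 2 <= s ^+ 2 by nra.
    nra.
rewrite I0 Rintegral_cst // lebesgue_segment; last by clear -s0; lra.
apply/negP; rewrite -ltNge mulr_gt0 ?divr_gt0 //; lra.
Qed.

End cauchy.

(** * Cauchy's formula on squares, the maximum principle and Taylor's estimate *)

Section maximum.
Variable R : realType.
Local Notation C := (R[i]^o).
Local Notation abs := (@modulus R).
Local Notation Re := (@complex.Re R).
Local Notation Im := (@complex.Im R).
Implicit Types (f g : C -> C) (a b c d r e x y s : R) (z w : C).

Definition csquare z s : set C := rect (Re z - s) (Re z + s) (Im z - s) (Im z + s).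
Definition csquare_bd z s : set C :=
  rect_bd (Re z - s) (Re z + s) (Im z - s) (Im z + s).

Lemma csquare_abs z s w : csquare z s w -> abs (w - z) <= 2 * s.
Proof.
move=> [w1 w2]; apply: (le_trans (modulus_ReIm _)).
have -> : Re (w - z) = Re w - Re z by case: (w) (z) => [? ?] [? ?].
have -> : Im (w - z) = Im w - Im z by case: (w) (z) => [? ?] [? ?].
have h1 : `|Re w - Re z| <= s by rewrite ler_norml; clear -w1; lra.
have h2 : `|Im w - Im z| <= s by rewrite ler_norml; clear -w2; lra.
by clear -h1 h2; lra.
Qed.

Lemma csquare_bd_abs z s w : csquare_bd z s w -> s <= abs (w - z).
Proof.
move=> [_ h].
have [h1|h1] : s <= `|Re w - Re z| \/ s <= `|Im w - Im z|.
  have [s0|s0] := leP 0 s; last by left; apply: le_trans (ltW s0) _.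
  by case: h => ->; [left|left|right|right];
    rewrite addrC addrA addNr add0r ?normrN ger0_norm.
- apply: (le_trans h1); rewrite (_ : Re w - Re z = Re (w - z)) ?Re_modulus //.
  by case: (w) (z) => [? ?] [? ?].
- apply: (le_trans h1); rewrite (_ : Im w - Im z = Im (w - z)) ?Im_modulus //.
  by case: (w) (z) => [? ?] [? ?].
Qed.

Lemma derivable_shift_inv z w : w != z -> derivable (fun w : C => (w - z)^-1) w 1.
Proof.
move=> wz; apply: holoV; last by rewrite subr_eq0.
by apply: holoB; [exact: holo_id|exact: holo_cst].
Qed.

Lemma cauchy_cst_indep s s' : 0 < s -> s < s' -> cauchy_cst s' = cauchy_cst s.
Proof.
move=> s0 ss; rewrite /cauchy_cst {1}/square_int /= !add0r.
rewrite (@rect_int_isolate _ _ _ _ _ _ (0 : C) s) //=; rewrite ?add0r; try by clear -ss; lra.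
by move=> w _; exact: derivable_inv.
Qed.

(** The integral of 1/(w - z) is the same on a big square around z0 as on a
    small one around z, which a translation moves to the origin. *)
Lemma cauchy_cst_off z z0 s : 0 < s ->
  `|Re z - Re z0| < s -> `|Im z - Im z0| < s ->
  square_int (fun w => (w - z)^-1) z0 s = cauchy_cst s.
Proof.
move=> s0; rewrite !ltr_norml => h1 h2.
pose m := Num.min (Num.min (Re z - Re z0 + s) (s - (Re z - Re z0)))
                  (Num.min (Im z - Im z0 + s) (s - (Im z - Im z0))).
have m0 : 0 < m by rewrite /m !lt_min; apply/andP; split; apply/andP; split; lra.
pose t := m / 2.
have : t < m by rewrite /t; lra.
have t0 : 0 < t by rewrite /t; lra.
rewrite /m !lt_min => /andP[/andP[t1 t2] /andP[t3 t4]].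
rewrite /square_int (@rect_int_isolate _ _ _ _ _ _ z t t0); [|lra|lra|lra|lra|]; last first.
  by move=> w _; exact: derivable_shift_inv.
rewrite square_int_translate; [|exact: ltW|]; last first.
  move=> w wbd; apply/derivable_continuous/derivable_shift_inv.
  apply/eqP => wz; have := csquare_bd_abs wbd; rewrite wz subrr modulus0.
  by clear -t0; lra.
rewrite (@cauchy_cst_indep t s t0); last by lra.
by apply: (congr1 (fun h => square_int h 0 t)); apply/funext => w; rewrite addrK.
Qed.

(** The quotient (f w - f z) / (w - z) is bounded near z, so that its integral
    vanishes. *)
Theorem cauchy_formula f z z0 s : 0 < s ->
  `|Re z - Re z0| < s -> `|Im z - Im z0| < s ->
  (forall w, csquare z0 s w -> derivable f w 1) ->
  square_int (fun w => (w - z)^-1 * f w) z0 s = cauchy_cst s * f z.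
Proof.
move=> s0 zr zi fd; have offc := cauchy_cst_off s0 zr zi.
move: zr zi; rewrite !ltr_norml => zr zi.
have [D DP] : exists d : C, forall e, 0 < e -> exists2 r, 0 < r &
    forall w, abs (w - z) < r -> abs (f w - f z - d * (w - z)) <= e * abs (w - z).
  by apply: derivable_eps; apply: fd; split; lra.
have [r r0 rP] := DP 1 ltr01.
pose K w := (w - z)^-1 * (f w - f z).
have Kd w : csquare z0 s w -> w != z -> derivable K w 1.
  move=> wS wz; apply: holoM; first exact: derivable_shift_inv.
  by apply: holoB; [exact: fd|exact: holo_cst].
have bdz w : csquare_bd z0 s w -> w != z.
  by move=> [_ h]; apply/eqP => wz; move: h; rewrite wz => -[]; lra.
have K0 : square_int K z0 s = 0.
  pose m := Num.min (r / 2) (Num.min (Num.min (Re z - Re z0 + s) (s - (Re z - Re z0)))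
                    (Num.min (Im z - Im z0 + s) (s - (Im z - Im z0)))).
  have m0 : 0 < m.
    by rewrite /m !lt_min divr_gt0 //=; apply/andP; split; apply/andP; split; lra.
  pose t := m / 2.
  have : t < m by rewrite /t; clear -m0; lra.
  have t0 : 0 < t by rewrite /t; clear -m0; lra.
  rewrite /m !lt_min => /andP[tr /andP[/andP[t1 t2] /andP[t3 t4]]].
  rewrite /square_int (@rect_int_isolate _ _ _ _ _ _ z t t0); [|lra|lra|lra|lra|exact: Kd].
  apply: (@rect_int_bounded_singularity _ _ _ _ _ _ z (abs D + 1)); [lra|lra| |].
    by move=> w [w1 w2]; apply: Kd; split; lra.
  move=> w /csquare_abs wt wz.
  have wr : abs (w - z) < r by apply: (le_lt_trans wt); clear -tr; lra.
  have wz0 : 0 < abs (w - z) by rewrite modulus_gt0 subr_eq0.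
  rewrite /K modulusM modulusV mulrC ler_pdivrMr //.
  have -> : f w - f z = (f w - f z - D * (w - z)) + D * (w - z) by rewrite subrK.
  apply: (le_trans (modulusD _ _)); rewrite modulusM.
  by have := rP w wr; clear; lra.
have ss1 : Re z0 - s <= Re z0 + s by clear -s0; lra.
have ss2 : Im z0 - s <= Im z0 + s by clear -s0; lra.
have Kc : rcts K (Re z0 - s) (Re z0 + s) (Im z0 - s) (Im z0 + s).
  apply: rctsP => [||w wbd]; [exact: ss1|exact: ss2|].
  by apply: derivable_continuous; apply: Kd; [case: wbd|exact: bdz].
have Ic : rcts (fun w => (w - z)^-1) (Re z0 - s) (Re z0 + s) (Im z0 - s) (Im z0 + s).
  apply: rctsP => [||w wbd]; [exact: ss1|exact: ss2|].
  by apply: derivable_continuous; apply: derivable_shift_inv; exact: bdz.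
have Jc : rcts (fun w => f z * (w - z)^-1) (Re z0 - s) (Re z0 + s) (Im z0 - s) (Im z0 + s).
  apply: rctsP => [||w wbd]; [exact: ss1|exact: ss2|].
  apply: derivable_continuous; apply: holoM; first exact: holo_cst.
  by apply: derivable_shift_inv; exact: bdz.
have := rect_intD Jc Kc; rewrite (rect_intZ _ Ic) -/(square_int _ z0 s) -/(square_int _ z0 s) -/(square_int _ z0 s).
rewrite offc K0 addr0 mulrC => <-; apply: eq_rect_int => [||w _]; [exact: ss1|exact: ss2|].
by rewrite /K; ring.
Qed.

Lemma square_int_bound f z s (M : R) : 0 < s ->
  (forall w, csquare_bd z s w -> {for w, continuous f}) ->
  (forall w, csquare_bd z s w -> abs (f w) <= M) ->
  abs (square_int f z s) <= 16 * M * s.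
Proof.
move=> s0 fc fM.
have ss1 : Re z - s <= Re z + s by clear -s0; lra.
have ss2 : Im z - s <= Im z + s by clear -s0; lra.
apply: (le_trans (rect_int_bound ss1 ss2 (rctsP ss1 ss2 fc) fM)).
by clear; lra.
Qed.

Lemma cauchy_estimate f z s (M : R) : 0 < s ->
  (forall w, csquare z s w -> derivable f w 1) ->
  (forall w, csquare_bd z s w -> abs (f w) <= M) ->
  abs (f z) <= 16 / abs (cauchy_cst s) * M.
Proof.
move=> s0 fd fM.
have k0 : 0 < abs (cauchy_cst s) by rewrite modulus_gt0 cauchy_cst_neq0.
rewrite mulrAC ler_pdivlMr // mulrC -modulusM.
rewrite -(@cauchy_formula f z z s) ?subrr ?normr0 //.
have wz w : csquare_bd z s w -> w != z.
  by move=> /csquare_bd_abs ws; rewrite -subr_eq0 -modulus_gt0; apply: lt_le_trans ws.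
have := @square_int_bound (fun w => (w - z)^-1 * f w) z s (M / s) s0.
rewrite -mulrA divfK ?gt_eqF //; apply=> w wbd.
  apply: derivable_continuous; apply: holoM.
    by apply: derivable_shift_inv; exact: wz.
  by apply: fd; case: wbd.
rewrite modulusM modulusV mulrC.
have sw := csquare_bd_abs wbd.
have M0 : 0 <= M by apply: le_trans (fM _ wbd); exact: modulus_ge0.
apply: ler_pM; [exact: modulus_ge0|by rewrite invr_ge0 modulus_ge0|exact: fM|].
by rewrite lef_pV2 ?posrE // (lt_le_trans s0).
Qed.

(** Cauchy's estimate for f^k reads |f z|^k <= A (t |f z|)^k with A independent
    of k. *)
Lemma no_strict_max f z s (t : R) : 0 < s -> 0 <= t < 1 ->
  (forall w, csquare z s w -> derivable f w 1) ->
  (forall w, csquare_bd z s w -> abs (f w) <= t * abs (f z)) -> f z = 0.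
Proof.
move=> s0 /andP[t0 t1] fd ft; apply/eqP; rewrite -modulus_eq0; apply/negPn.
rewrite modulus_eq0 -modulus_gt0; apply/negP => fz0.
pose A := 16 / abs (cauchy_cst s).
have H k : 1 <= A * t ^+ k.
  have fkd w : csquare z s w -> derivable (fun w => f w ^+ k) w 1.
    by move=> ws; apply: holoX; exact: fd.
  have fkM w : csquare_bd z s w -> abs (f w ^+ k) <= t ^+ k * abs (f z) ^+ k.
    move=> ws; rewrite modulusX -exprMn; apply: lerXn2r; last exact: ft.
      by rewrite nnegrE modulus_ge0.
    by rewrite nnegrE mulr_ge0 // modulus_ge0.
  have := cauchy_estimate s0 fkd fkM.
  by rewrite modulusX mulrA -[leLHS]mul1r ler_pM2r // exprn_gt0.
have A0 : 0 < A by have := H 0%N; rewrite expr0 mulr1; clear; lra.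
have := @cvg_expr R t; rewrite ger0_norm // => /(_ t1)/cvgrPdist_lt /(_ A^-1).
rewrite invr_gt0 => /(_ A0)[k _ /(_ k (leqnn k))].
rewrite /= sub0r normrN ger0_norm ?exprn_ge0 // => Hk.
have := H k; apply/negP; rewrite -ltNge mulrC -ltr_pdivlMr //.
by rewrite mul1r.
Qed.

(** Lagrange's identity for the vectors (1, sqrt t z) and (1, sqrt t w). *)
Lemma modulus_conj_identity z w (t : R) :
  abs (1 + t%:C * conjc z * w) ^+ 2 =
  (1 + t * abs w ^+ 2) * (1 + t * abs z ^+ 2) - t * abs (w - z) ^+ 2.
Proof.
by rewrite !modulus_sqr; case: z w => [x y] [u v] /=; ring.
Qed.

Lemma compact_bounded (K : set C) : compact K ->
  exists2 B, 0 < B & forall z, K z -> abs z <= B.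
Proof.
move=> cK; have [K0|/set0P K0] := eqVneq K set0.
  by exists 1 => // z; rewrite K0.
have [b Kb bP] := compact_EVT_max K0 cK (continuous_subspaceT (@continuous_modulus R)).
exists (abs b + 1) => [|z /mem_set/bP h]; first by have := modulus_ge0 b; lra.
by apply: (le_trans h); lra.
Qed.

Lemma real_continuous_ptD (f g : C -> R) z : {for z, continuous f} ->
  {for z, continuous g} -> {for z, continuous (fun w => f w + g w)}.
Proof. by move=> fz gz; exact: (cvgD fz gz). Qed.

Lemma real_continuous_ptM (f g : C -> R) z : {for z, continuous f} ->
  {for z, continuous g} -> {for z, continuous (fun w => f w * g w)}.
Proof. by move=> fz gz; exact: (cvgM fz gz). Qed.

Lemma real_continuous_cst (r : R) z : {for z, continuous ((fun=> r) : C -> R)}.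
Proof. exact: cst_continuous. Qed.

(** The weight 1 + t |z|^2 makes the maximum strict.  If |f z|^2 (1 + t |z|^2) is
    maximal at an interior point a, multiply f by the polynomial
    (1 + t conj(a) z) / (1 + t |a|^2), which is 1 at a: by Lagrange's identity the
    product is smaller than |f a| by a constant factor on a small square around a,
    against [no_strict_max].  For small t the weight does not matter. *)
Theorem maximum_principle f (K U : set C) (M : R) : compact K -> open U ->
  U `<=` K -> 0 <= M ->
  (forall z, K z -> {for z, continuous f}) ->
  (forall z, U z -> derivable f z 1) ->
  (forall z, K z -> ~ U z -> abs (f z) <= M) ->
  forall z, K z -> abs (f z) <= M.
Proof.
move=> cK oU UK M0 fc fd fM z1 Kz1; rewrite leNgt; apply/negP => Mz1.
have [B B0 KB] := compact_bounded cK.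
pose F := abs (f z1).
have [t [t0 tP]] : exists t, 0 < t /\ M ^+ 2 * (1 + t * B ^+ 2) < F ^+ 2.
  exists ((F ^+ 2 - M ^+ 2) / (2 * (M ^+ 2 + 1) * B ^+ 2)).
  have B2 : 0 < B ^+ 2 by rewrite exprn_gt0.
  have MF : M ^+ 2 < F ^+ 2 by rewrite ltr_pXn2r // nnegrE modulus_ge0.
  have M2 : 0 <= M ^+ 2 by rewrite exprn_ge0.
  split; first by rewrite divr_gt0 // ?subr_gt0 // !mulr_gt0 //; lra.
  rewrite (_ : _ / _ * _ = (F ^+ 2 - M ^+ 2) / (2 * (M ^+ 2 + 1))); last first.
    have Bn0 : B != 0 by exact: lt0r_neq0.
    have Mn0 : M ^+ 2 + 1 != 0 by apply: lt0r_neq0; clear -M2; lra.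
    by field; rewrite ?Bn0 ?Mn0.
  move: M2 MF; move: (M ^+ 2) (F ^+ 2) => m u m0 mu.
  rewrite mulrDr mulr1 mulrA -ltrBrDl ltr_pdivrMr; last by lra.
  nra.
pose G z := abs (f z) ^+ 2 * (1 + t * abs z ^+ 2).
have Gc : {within K, continuous G}.
  apply: continuous_in_subspaceT => z /set_mem Kz.
  have c1 : {for z, continuous (fun z => abs (f z))}.
    by apply: (@continuous_comp _ _ _ f abs); [exact: fc|exact: continuous_modulus].
  have c2 : {for z, continuous (abs : C -> R)} by exact: continuous_modulus.
  have c3 := real_continuous_ptM c2 c2.
  have c4 := real_continuous_ptM (@real_continuous_cst t z) c3.
  have c5 := real_continuous_ptD (@real_continuous_cst 1 z) c4.
  exact: real_continuous_ptM (real_continuous_ptM c1 c1) c5.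
have [a /set_mem Ka aP] := compact_EVT_max (ex_intro _ z1 Kz1) cK Gc.
have w0 z : 0 < 1 + t * abs z ^+ 2 by rewrite ltr_pwDl // mulr_ge0 ?exprn_ge0 ?modulus_ge0 // ltW.
have wB z : K z -> 1 + t * abs z ^+ 2 <= 1 + t * B ^+ 2.
  move=> /KB zB; rewrite lerD2l ler_pM2l // lerXn2r // nnegrE ?modulus_ge0 //.
  exact: ltW.
have Ga : F ^+ 2 <= G a.
  apply: le_trans (aP z1 (mem_set Kz1)); rewrite /G -/F ler_peMr ?exprn_ge0 ?modulus_ge0 //.
  by rewrite lerDl mulr_ge0 ?exprn_ge0 ?modulus_ge0 // ltW.
have Ua : U a.
  apply: contrapT => nUa; move: Ga; apply/negP; rewrite -ltNge.
  apply: le_lt_trans tP; apply: ler_pM; rewrite ?exprn_ge0 ?modulus_ge0 //.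
  - exact: ltW.
  - by apply: lerXn2r; rewrite ?nnegrE ?modulus_ge0 //; exact: fM.
  - exact: wB.
have [e e0 eU] := (openCP U).1 oU a Ua.
pose s := e / 3.
have s0 : 0 < s by rewrite divr_gt0.
have sU w : csquare a s w -> U w.
  by move=> /csquare_abs h; apply: eU; apply: (le_lt_trans h); rewrite /s; lra.
pose W := 1 + t * abs a ^+ 2.
pose h w := f w * (W^-1)%:C * (1 + t%:C * conjc a * w).
have ha : h a = f a.
  rewrite /h (_ : 1 + _ = W%:C).
    by rewrite -mulrA -rmorphM mulVf ?gt_eqF ?w0 // mulr1.
  apply/eqP; rewrite eq_complex /W modulus_sqr; case: (a) => x y /=.
  by apply/andP; split; apply/eqP; ring.
have hd w : csquare a s w -> derivable h w 1.
  move=> /sU/fd fw; apply: holoM; last first.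
    apply: holoD; first exact: holo_cst.
    by apply: holoM; [exact: holo_cst|exact: holo_id].
  by apply: holoM; [exact: fw|exact: holo_cst].
pose q := 1 - t * s ^+ 2 / (1 + t * B ^+ 2) ^+ 2.
have V0 : 0 < 1 + t * B ^+ 2 by apply: lt_le_trans (w0 a) (wB a Ka).
have hq w : csquare_bd a s w -> abs (h w) ^+ 2 <= q * abs (f a) ^+ 2.
  move=> wb; have Kw : K w by apply: UK; apply: sU; case: wb.
  have saw := csquare_bd_abs wb.
  have Wi : 0 <= W^-1 by rewrite invr_ge0; exact/ltW/w0.
  rewrite /h !modulusM !exprMn modulusC (ger0_norm Wi) modulus_conj_identity.
  rewrite -/W; have := aP w (mem_set Kw); rewrite /G -/W.
  have := w0 w; have := wB w Kw; have := w0 a; have := wB a Ka; rewrite -/W.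
  set X := 1 + t * abs w ^+ 2; set V := 1 + t * B ^+ 2 in q V0 *.
  move=> WV W0 XV X0 GG.
  have fw : abs (f w) ^+ 2 <= abs (f a) ^+ 2 * W / X by rewrite ler_pdivlMr.
  have s2 : s ^+ 2 <= abs (w - a) ^+ 2.
    by apply: lerXn2r => //; rewrite nnegrE ?modulus_ge0 // ltW.
  apply: (@le_trans _ _ (abs (f a) ^+ 2 * W / X * W^-1 ^+ 2 * (X * W - t * abs (w - a) ^+ 2))).
    apply: ler_wpM2r.
      by rewrite -modulus_conj_identity exprn_ge0 ?modulus_ge0.
    by apply: ler_wpM2r; rewrite ?exprn_ge0 // invr_ge0 ltW.
  rewrite (_ : _ * (_ - _) = (1 - t * abs (w - a) ^+ 2 / (X * W)) * abs (f a) ^+ 2); last first.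
    have Xn0 := lt0r_neq0 X0; have Wn0 := lt0r_neq0 W0.
    by field; rewrite ?Xn0 ?Wn0.
  apply: ler_wpM2r; first by rewrite exprn_ge0 ?modulus_ge0.
  rewrite /q lerD2l lerN2 (expr2 V); apply: ler_pM.
  - by apply: mulr_ge0; [exact: ltW|apply: exprn_ge0; exact: ltW].
  - by rewrite invr_ge0; apply: mulr_ge0; exact: ltW.
  - by rewrite ler_pM2l.
  - by rewrite lef_pV2 ?posrE ?mulr_gt0 //; apply: ler_pM; [exact: ltW|exact: ltW|exact: XV|exact: WV].
have F0 : 0 < F ^+ 2 by rewrite exprn_gt0 // (le_lt_trans M0).
have fa0 : 0 < abs (f a).
  rewrite lt_neqAle modulus_ge0 andbT eq_sym; apply/eqP => fa.
  by move: Ga; rewrite /G fa expr0n mul0r; lra.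
have q1 : q < 1 by rewrite /q gtrBl divr_gt0 ?mulr_gt0 ?exprn_gt0.
have q0 : 0 <= q.
  have wb : csquare_bd a s ((Re a - s) +i* Im a).
    by split => /=; [split => /=; clear -s0; lra|constructor 1].
  have := hq _ wb => /(le_trans (sqr_ge0 _)); rewrite pmulr_lge0 // exprn_gt0 //.
have := @no_strict_max h a s (Num.sqrt q) s0.
rewrite sqrtr_ge0 -sqrtr1 ltr_sqrt // q1 ha => /(_ isT hd) fa.
have : f a = 0.
  apply: fa => w /hq hw; rewrite -(@ler_pXn2r _ 2) ?nnegrE ?modulus_ge0 //.
    by rewrite exprMn sqr_sqrtr.
  by rewrite mulr_ge0 ?sqrtr_ge0 ?modulus_ge0.
by move=> fa00; move: fa0; rewrite fa00 modulus0 ltxx.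
Qed.

(** In Cauchy's formula, 1/(v - z) is expanded n times by
    1/(v - z) = 1/v + (z/v) / (v - z). *)
Theorem taylor f r n : 0 < r -> (forall w, abs w < r -> derivable f w 1) ->
  exists (c : nat -> C) (B : R) (r' : R), 0 < r' /\
    forall z, abs z < r' -> abs (f z - \sum_(k < n) c k * z ^+ k) <= B * abs z ^+ n.
Proof.
move=> r0 fd.
have [D DP] : exists d : C, forall e, 0 < e -> exists2 r, 0 < r &
    forall w, abs (w - 0) < r -> abs (f w - f 0 - d * (w - 0)) <= e * abs (w - 0).
  by apply: derivable_eps; apply: fd; rewrite modulus0.
have [r1 r10 rP] := DP 1 ltr01.
pose s := Num.min r r1 / 3.
have m0 : 0 < Num.min r r1 by rewrite lt_min r0.
have s0 : 0 < s by rewrite divr_gt0.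
have [sr sr1] : 2 * s < r /\ 2 * s < r1.
  have : 2 * s < Num.min r r1 by rewrite /s; clear -m0; lra.
  by rewrite lt_min => /andP.
have sqr w : csquare 0 s w -> abs w <= 2 * s.
  by move=> /csquare_abs; rewrite subr0.
have fS w : csquare 0 s w -> derivable f w 1.
  by move=> /sqr h; apply: fd; exact: le_lt_trans sr.
pose M := abs (f 0) + (abs D + 1) * r.
have fM w : csquare 0 s w -> abs (f w) <= M.
  move=> /sqr h; have := rP w; rewrite subr0 => /(_ (le_lt_trans h sr1)) h1.
  have h2 : abs w <= r by apply/ltW/(le_lt_trans h).
  have := modulusD (f 0) (D * w + (f w - f 0 - D * w)).
  rewrite (_ : f 0 + (D * w + _) = f w); last by ring.
  move=> /le_trans; apply; rewrite /M lerD2l; apply: (le_trans (modulusD _ _)).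
  rewrite modulusM mulrDl mul1r; apply: lerD; first by apply: ler_wpM2l => //; exact: modulus_ge0.
  by apply: (le_trans h1); rewrite mul1r.
have bd_ge w : csquare_bd 0 s w -> s <= abs w.
  by move=> /csquare_bd_abs; rewrite subr0.
have bd0 w : csquare_bd 0 s w -> w != 0.
  by move=> /bd_ge h; rewrite -modulus_gt0; exact: lt_le_trans h.
have bdz z w : abs z < s / 2 -> csquare_bd 0 s w -> s / 2 <= abs (w - z).
  by move=> zs /bd_ge h; have := modulus_leB w z; clear -zs h; lra.
have bdz' z w : abs z < s / 2 -> csquare_bd 0 s w -> w != z.
  move=> zs /(bdz _ _ zs) h; rewrite -subr_eq0 -modulus_gt0.
  by apply: lt_le_trans h; rewrite divr_gt0.
pose T k z := square_int (fun w => w^-1 ^+ k * (w - z)^-1 * f w) 0 s.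
pose A k := square_int (fun w => w^-1 ^+ k.+1 * f w) 0 s.
have ss : (0 : R) - s <= 0 + s by clear -s0; lra.
have dA k w : csquare_bd 0 s w -> {for w, continuous (fun w => w^-1 ^+ k.+1 * f w)}.
  move=> wb; apply: derivable_continuous; apply: holoM; last first.
    by apply: fS; case: wb.
  by apply: holoX; apply: derivable_inv; exact: bd0.
have dT k z w : abs z < s / 2 -> csquare_bd 0 s w ->
    {for w, continuous (fun w => w^-1 ^+ k * (w - z)^-1 * f w)}.
  move=> zs wb; apply: derivable_continuous; apply: holoM; last first.
    by apply: fS; case: wb.
  apply: holoM.
    by apply: holoX; apply: derivable_inv; exact: bd0.
  by apply: derivable_shift_inv; exact: bdz'.
have TS k z : abs z < s / 2 -> T k z = A k + z * T k.+1 z.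
  move=> zs; rewrite /T /A /square_int.
  have cA := rctsP ss ss (dA k).
  have cT := rctsP ss ss (fun w => @dT k.+1 z w zs).
  have cT' : rcts (fun w => z * (w^-1 ^+ k.+1 * (w - z)^-1 * f w)) (0 - s) (0 + s) (0 - s) (0 + s).
    apply: rctsP => [||w wb]; [exact: ss|exact: ss|].
    exact: (continuous_ptM (derivable_continuous (@holo_cst R z w)) (@dT k.+1 z w zs wb)).
  rewrite /= -(rect_intZ _ cT) -(rect_intD cA cT').
  apply: eq_rect_int => [||w wb]; [exact: ss|exact: ss|].
  have w0 := bd0 _ wb; have wz : w - z != 0 by rewrite subr_eq0; exact: bdz' wb.
  rewrite exprS; move: (w^-1 ^+ k) (f w) => p v.
  by field; rewrite w0 wz.
have expand k z : abs z < s / 2 ->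
    cauchy_cst s * f z = (\sum_(j < k) A j * z ^+ j) + z ^+ k * T k z.
  move=> zs; elim: k => [|k ->].
    rewrite big_ord0 add0r expr0 mul1r -(@cauchy_formula f z 0 s) //=.
    - by apply: (congr1 (fun h => square_int h 0 s)); apply/funext => w; rewrite expr0 mul1r.
    - by rewrite subr0; apply: (le_lt_trans (Re_modulus _)); clear -zs s0; lra.
    - by rewrite subr0; apply: (le_lt_trans (Im_modulus _)); clear -zs s0; lra.
  by rewrite big_ord_recr /= -addrA TS // mulrDr mulrA -exprSr [A k * _]mulrC.
pose kap := cauchy_cst s.
have kap0 : kap != 0 by exact: cauchy_cst_neq0.
exists (fun j => A j / kap), (16 * (s^-1 ^+ n * (s / 2)^-1 * M) * s / abs kap), (s / 2).
split; first by rewrite divr_gt0.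
move=> z zs.
have -> : f z - \sum_(k < n) A k / kap * z ^+ k = z ^+ n * T n z / kap.
  have := expand n z zs; rewrite -/kap => /(canRL (mulKf kap0)) ->.
  have -> : \sum_(k < n) A k / kap * z ^+ k = kap^-1 * \sum_(k < n) A k * z ^+ k.
    by rewrite mulr_sumr; apply: eq_bigr => i _; rewrite mulrA [_ * A i]mulrC.
  by rewrite mulrDr addrAC subrr add0r mulrC.
rewrite !modulusM modulusV modulusX -mulrA mulrC ler_wpM2r ?exprn_ge0 ?modulus_ge0 //.
rewrite ler_wpM2r ?invr_ge0 ?modulus_ge0 //.
have M0 : 0 <= M.
  apply: le_trans (fM 0 _); first exact: modulus_ge0.
  by split => /=; clear -s0; lra.
apply: square_int_bound => // w wb; first exact: dT.
rewrite !modulusM modulusX !modulusV.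
have s2 : 0 < s / 2 by rewrite divr_gt0.
apply: ler_pM.
- by rewrite mulr_ge0 ?exprn_ge0 ?invr_ge0 ?modulus_ge0.
- exact: modulus_ge0.
- apply: ler_pM; rewrite ?exprn_ge0 ?invr_ge0 ?modulus_ge0 //.
  + apply: lerXn2r; rewrite ?nnegrE ?invr_ge0 ?modulus_ge0 ?(ltW s0) //.
    by rewrite lef_pV2 ?posrE ?bd_ge // (lt_le_trans s0) ?bd_ge.
  + by rewrite lef_pV2 ?posrE ?bdz // (lt_le_trans s2) ?bdz.
- by apply: fM; case: wb.
Qed.

End maximum.

(** * An upper bound from the rotational symmetry *)

Section upper.
Variable R : realType.
Local Notation C := (R[i]^o).
Local Notation abs := (@modulus R).

(** Taking k-th roots removes the constant B. *)
Lemma le_of_pow_le (a b B : R) : 0 <= a -> 0 < b ->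
  (forall k, a ^+ k <= B * b ^+ k) -> a <= b.
Proof.
move=> a0 b0 H; rewrite leNgt; apply/negP => ba.
have a1 : 0 < a by exact: lt_trans ba.
have B0 : 0 < B by have := H 0%N; rewrite !expr0 mulr1; lra.
have t0 : 0 <= b / a by rewrite divr_ge0 // ltW.
have := @cvg_expr R (b / a); rewrite ger0_norm // ltr_pdivrMr // mul1r => /(_ ba).
move=> /cvgrPdist_lt /(_ B^-1).
rewrite invr_gt0 => /(_ B0)[k _ /(_ k (leqnn k))].
rewrite /= sub0r normrN ger0_norm ?exprn_ge0 // => Hk.
have := H k; apply/negP; rewrite -ltNge.
by move: Hk; rewrite expr_div_n ltr_pdivrMr ?exprn_gt0 // mulrC ltr_pdivlMr // mulrC.
Qed.

Lemma sum_root_pow (n : nat) (w : C) (k : nat) : n.-primitive_root w ->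
  (0 < k < n)%N -> \sum_(j < n) (w ^+ j) ^+ k = 0.
Proof.
move=> wn /andP[k0 kn].
have wk1 : w ^+ k != 1.
  rewrite -(prim_order_dvd wn); apply/negP => /dvdn_leq -/(_ k0).
  by rewrite leqNgt kn.
have := subrX1 (w ^+ k) n.
rewrite -exprM mulnC exprM (prim_expr_order wn) expr1n subrr => /esym/eqP.
rewrite mulf_eq0 subr_eq0 (negbTE wk1) /= => /eqP s0; rewrite -[RHS]s0.
by apply: eq_bigr => j _; rewrite -!exprM mulnC.
Qed.

Variables (n : nat) (w : C).
Hypothesis wn : n.-primitive_root w.

(** In the coordinate zeta = 1 + 1/z this is z^n (zeta^n - 1). *)
Definition power_gap (z : C) : C := (1 + z) ^+ n - z ^+ n.
(** The region |zeta^n - 1| >= d, the exterior of a lemniscate around the roots of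
    unity, written so that it also makes sense at z = 0, that is at zeta = oo. *)
Definition lemniscate_ext (d : R) : set C := [set z | d * abs z ^+ n <= abs (power_gap z)].
(** The rotation of the coordinate zeta by w^-j; it fixes z = 0 and z = -1. *)
Definition root_rotation j (z : C) : C := w ^+ j * z / (1 + z - w ^+ j * z).

Let n0 : (0 < n)%N. Proof. exact: prim_order_gt0 wn. Qed.

Let wj_n j : (w ^+ j) ^+ n = 1.
Proof. by rewrite -exprM mulnC exprM (prim_expr_order wn) expr1n. Qed.

Lemma root_modulus j : abs (w ^+ j) = 1.
Proof.
have := congr1 abs (wj_n j); rewrite modulusX modulus1 => /eqP.
by rewrite pexprn_eq1 ?modulus_ge0 // eqn0Ngt n0 => /eqP.
Qed.

Lemma rotation_denominator_neq0 (d : R) j (z : C) : 0 < d -> lemniscate_ext d z -> 1 + z - w ^+ j * z != 0.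
Proof.
move=> d0 Kz; apply/negP => /eqP/subr0_eq H.
have D0 : power_gap z = 0.
  by rewrite /power_gap H exprMn wj_n mul1r subrr.
move: Kz; rewrite /lemniscate_ext /= D0 modulus0 => h.
have z0 : z = 0.
  apply/eqP; rewrite -modulus_eq0 eq_le modulus_ge0 andbT leNgt; apply/negP => z0.
  by move: h; apply/negP; rewrite -ltNge mulr_gt0 // exprn_gt0.
by move: H; rewrite z0 mulr0 addr0 => /eqP; rewrite oner_eq0.
Qed.

Lemma lemniscate_ext_rotation (d : R) j (z : C) : 0 < d -> lemniscate_ext d z -> lemniscate_ext d (root_rotation j z).
Proof.
move=> d0 Kz; have den0 := rotation_denominator_neq0 j d0 Kz; rewrite /lemniscate_ext /=.
have -> : power_gap (root_rotation j z) = power_gap z / (1 + z - w ^+ j * z) ^+ n.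
  rewrite /power_gap /root_rotation (_ : 1 + _ = (1 + z) / (1 + z - w ^+ j * z)).
    by rewrite !expr_div_n exprMn wj_n mul1r mulrBl.
  by field.
rewrite /root_rotation !modulusM root_modulus mul1r !modulusV modulusX expr_div_n mulrA.
by apply: ler_wpM2r; rewrite // invr_ge0 exprn_ge0 ?modulus_ge0.
Qed.

Lemma derivable_power_gap z : derivable power_gap z 1.
Proof.
apply: holoB; apply: holoX; last exact: holo_id.
by apply: holoD; [exact: holo_cst|exact: holo_id].
Qed.

Lemma power_gap_bound (z : C) : 1 <= abs z -> abs (power_gap z) <= n%:R * (2 * abs z) ^+ n.-1.
Proof.
move=> z1; rewrite /power_gap subrXX (_ : 1 + z - z = 1) ?mul1r; last by ring.
apply: (le_trans (modulus_sum _ _ _)).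
apply: (@le_trans _ _ (\sum_(i < n) (2 * abs z) ^+ n.-1)); last first.
  by rewrite sumr_const card_ord -[_ *+ n]mulr_natl.
apply: ler_sum => i _; rewrite modulusM !modulusX.
have in1 : (n.-1 = (n.-1 - i) + i)%N by have := ltn_ord i; lia.
rewrite [X in _ <= _ ^+ X]in1 exprD; apply: ler_pM; rewrite ?exprn_ge0 ?modulus_ge0 //.
  by apply: lerXn2r; rewrite ?nnegrE ?modulus_ge0 //; [lra|
    apply: (le_trans (modulusD _ _)); rewrite modulus1; lra].
by apply: lerXn2r; rewrite ?nnegrE ?modulus_ge0 //; lra.
Qed.

Lemma lemniscate_ext_bounded (d : R) (z : C) : 0 < d -> lemniscate_ext d z ->
  abs z <= Num.max 1 (n%:R * 2 ^+ n.-1 / d).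
Proof.
move=> d0 Kz; rewrite le_max; have [//|z1] := leP (abs z) 1; rewrite /=.
have := le_trans Kz (power_gap_bound (ltW z1)).
rewrite -{1}(prednK n0) exprS exprMn mulrA [n%:R * _]mulrA.
rewrite ler_pM2r ?exprn_gt0 ?(lt_trans ltr01) //.
by rewrite ler_pdivlMr // mulrC.
Qed.

Lemma closed_bounded_compact (A : set C) (B : R) : closed A ->
  (forall z, A z -> abs z <= B) -> compact A.
Proof.
move=> cA AB; pose box := [set` `[- B, B]] `*` [set` `[- B, B]] : set (R * R).
have cbox : compact box by apply: compact_setX; exact: segment_compact.
pose h (p : R * R) : C := p.1 +i* p.2.
have ch : continuous h.
  move=> p X /nbhsCP[e e0 eX].
  have : nbhs p (ball p (e / 2)) by apply: nbhsx_ballx; rewrite divr_gt0.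
  apply: filterS => q [q1 q2]; apply: eX; apply: (le_lt_trans (modulus_ReIm _)).
  rewrite /h; case: p q q1 q2 => [p1 p2] [q1 q2]; rewrite /ball /= => h1 h2.
  by rewrite distrC [X in _ + X]distrC; lra.
have cim : compact (h @` box).
  by apply: continuous_compact => //; exact: continuous_subspaceT.
apply: subclosed_compact cA cim _ => z Az; have zB := AB z Az.
exists (complex.Re z, complex.Im z); last by rewrite /h; case: (z).
split; rewrite /= in_itv /= -ler_norml; apply: le_trans zB.
- exact: Re_modulus.
- exact: Im_modulus.
Qed.

Lemma closed_le_fun (f g : C -> R) : continuous f -> continuous g ->
  closed [set z | f z <= g z].
Proof.
move=> cf cg.
rewrite (_ : [set z | _] = (fun z => f z - g z) @^-1` [set x | x <= 0]).
  apply: closed_comp; last exact: closed_le.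
  move=> z _; exact: (cvgB (cf z) (cg z)).
by apply/seteqP; split => z /=; rewrite subr_le0.
Qed.

Lemma continuous_modulus_comp (f : C -> C) : (forall z, derivable f z 1) ->
  continuous (fun z => abs (f z)).
Proof.
move=> fd z; apply: (@continuous_comp _ _ _ f abs); last exact: continuous_modulus.
exact: derivable_continuous.
Qed.

Lemma continuous_scaled_modulus (d : R) k : continuous (fun z : C => d * abs z ^+ k).
Proof.
rewrite (_ : (fun z => _) = fun z => abs (d%:C) / abs (d%:C) * (d * abs (z ^+ k))); last first.
  apply/funext => z; rewrite modulusX.
  have [->|d0] := eqVneq d 0; first by rewrite !mul0r mulr0.
  by rewrite divff ?mul1r // modulusC normr_eq0.
move=> z; apply: real_continuous_ptM; first exact: real_continuous_cst.
apply: real_continuous_ptM; first exact: real_continuous_cst.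
by apply: continuous_modulus_comp => v; apply: holoX; exact: holo_id.
Qed.

Lemma lemniscate_ext_compact (d : R) : 0 < d -> compact (lemniscate_ext d).
Proof.
move=> d0; apply: (@closed_bounded_compact _ (Num.max 1 (n%:R * 2 ^+ n.-1 / d))).
  apply: closed_le_fun; first exact: continuous_scaled_modulus.
  by apply: continuous_modulus_comp => z; exact: derivable_power_gap.
by move=> z; exact: lemniscate_ext_bounded.
Qed.

(** In the coordinate u = z / (1 + z) = 1 / zeta the maps are the rotations
    u -> w^j u, and averaging over them kills the monomials u^k with 0 < k < n of
    the Taylor expansion. *)
Lemma symmetric_mean_order (f : C -> C) (r : R) : 0 < r ->
  (forall z, abs z < r -> derivable f z 1) -> f 0 = 0 ->
  exists B r' : R, 0 < r' /\
    forall z, abs z < r' -> abs (\sum_(j < n) f (root_rotation j z)) <= B * abs z ^+ n.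
Proof.
move=> r0 fd f0.
pose phi (u : C) : C := f (u / (1 - u)).
pose r1 := Num.min (1 / 2) (r / 2).
have r10 : 0 < r1 by rewrite lt_min !divr_gt0.
have phid u : abs u < r1 -> derivable phi u 1.
  rewrite lt_min => /andP[u1 u2].
  have u12 : 1 / 2 <= abs (1 - u).
    by have := modulus_leB 1 u; rewrite modulus1; lra.
  have u10 : 1 - u != 0 by rewrite -modulus_gt0; lra.
  apply: holo_comp; last first.
    apply: holoM; first exact: holo_id.
    apply: holoV; last exact: u10.
    by apply: holoB; [exact: holo_cst|exact: holo_id].
  apply: fd; rewrite modulusM modulusV ltr_pdivrMr; last by rewrite modulus_gt0.
  by have := modulus_ge0 u; nra.
have [c [B [r2 [r20 cB]]]] := taylor n r10 phid.
have c0 : c 0%N = 0.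
  have := cB 0; rewrite modulus0 => /(_ r20).
  rewrite expr0n eqn0Ngt n0 mulr0 /phi mul0r f0 sub0r modulusN.
  rewrite -(prednK n0) big_ord_recl expr0 mulr1 big1 ?addr0; last first.
    by move=> i _; rewrite /= exprS mul0r mulr0.
  move=> h; apply/eqP; rewrite -modulus_eq0 eq_le h; exact: modulus_ge0.
exists (n%:R * (`|B| * 2 ^+ n)), (Num.min (1 / 2) (r2 / 2)); split.
  by rewrite lt_min !divr_gt0.
move=> z; rewrite lt_min => /andP[z1 z2].
have z12 : 1 / 2 <= abs (1 + z).
  by have := modulus_leB 1 (- z); rewrite opprK modulusN modulus1; lra.
have z10 : 1 + z != 0 by rewrite -modulus_gt0; lra.
pose u := z / (1 + z).
have uz : abs u <= 2 * abs z.
  rewrite modulusM modulusV ler_pdivrMr; last by rewrite modulus_gt0.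
  by have := modulus_ge0 z; nra.
have den j : 1 + z - w ^+ j * z != 0.
  rewrite -modulus_gt0; have := modulus_leB (1 + z) (w ^+ j * z).
  rewrite modulusM root_modulus mul1r => h; have := modulus_leB 1 (- z).
  rewrite opprK modulusN modulus1; lra.
have fE j : f (root_rotation j z) = phi (w ^+ j * u).
  rewrite /phi /root_rotation /u; congr f; field.
  by rewrite z10; have := den j; rewrite mulrC => ->.
have sum0 : \sum_(j < n) \sum_(k < n) c k * (w ^+ j * u) ^+ k = 0.
  rewrite exchange_big /= big1 // => k _.
  rewrite (eq_bigr (fun j : 'I_n => (c k * u ^+ k) * (w ^+ j) ^+ k)); last first.
    by move=> j _; rewrite exprMn; ring.
  rewrite -mulr_sumr; have [k0|k0] := posnP k; first by rewrite k0 c0 !mul0r.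
  by rewrite sum_root_pow ?mulr0 // k0 ltn_ord.
have -> : \sum_(j < n) f (root_rotation j z) =
    \sum_(j < n) (phi (w ^+ j * u) - \sum_(k < n) c k * (w ^+ j * u) ^+ k).
  by rewrite sumrB sum0 subr0; apply: eq_bigr => j _; rewrite fE.
apply: (le_trans (modulus_sum _ _ _)).
apply: (@le_trans _ _ (\sum_(j < n) `|B| * 2 ^+ n * abs z ^+ n)); last first.
  by rewrite sumr_const card_ord -[_ *+ n]mulr_natl mulrA.
apply: ler_sum => j _.
have wu : abs (w ^+ j * u) = abs u by rewrite modulusM root_modulus mul1r.
apply: (le_trans (cB _ _)); first by rewrite wu; apply: (le_lt_trans uz); lra.
rewrite wu -mulrA -exprMn.
apply: (@le_trans _ _ (`|B| * abs u ^+ n)).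
  by apply: ler_wpM2r; [rewrite exprn_ge0 ?modulus_ge0|rewrite ler_norm].
apply: ler_wpM2l => //; apply: lerXn2r => //; rewrite nnegrE ?mulr_ge0 ?modulus_ge0 //.
Qed.

(** With F the mean of f over the rotations, h = F (zeta^n - 1) is bounded near
    z = 0 by [symmetric_mean_order] and has |h| <= d on the boundary of the region.
    The maximum principle is applied to z h^k rather than to h, because z h^k is
    continuous at the puncture z = 0, where it vanishes; letting k grow removes the
    factor z. *)
Theorem symmetric_upper_bound (f : C -> C) (d : R) : 0 < d <= 1 ->
  (forall z, lemniscate_ext d z -> derivable f z 1) -> (forall z, lemniscate_ext d z -> abs (f z) <= 1) ->
  f 0 = 0 -> abs (f (-1)) <= d.
Proof.
move=> /andP[d0 d1] fd f1 f00.
have nz : n%:R != 0 :> C by rewrite pnatr_eq0 -lt0n.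
pose F z := (n%:R : C)^-1 * \sum_(j < n) f (root_rotation j z).
pose h z := F z * (power_gap z / z ^+ n).
have rotd j z : lemniscate_ext d z -> derivable (root_rotation j) z 1.
  move=> Kz; apply: holoM.
    by apply: holoM; [exact: holo_cst|exact: holo_id].
  apply: holoV; last exact: rotation_denominator_neq0 Kz.
  apply: holoB; first by apply: holoD; [exact: holo_cst|exact: holo_id].
  by apply: holoM; [exact: holo_cst|exact: holo_id].
have Fd z : lemniscate_ext d z -> derivable F z 1.
  move=> Kz; apply: holoM; first exact: holo_cst.
  apply: holo_sum => j; apply: holo_comp; last exact: rotd.
  by apply: fd; exact: lemniscate_ext_rotation.
have F1 z : lemniscate_ext d z -> abs (F z) <= 1.
  move=> Kz; rewrite /F modulusM modulusV.
  have -> : abs (n%:R : C) = n%:R.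
    by rewrite -(rmorph_nat (real_complex R)) modulusC ger0_norm.
  rewrite mulrC ler_pdivrMr ?ltr0n // mul1r.
  apply: (le_trans (modulus_sum _ _ _)).
  apply: (@le_trans _ _ (\sum_(j < n) 1)); last by rewrite sumr_const card_ord.
  by apply: ler_sum => j _; apply: f1; exact: lemniscate_ext_rotation.
have hd z : lemniscate_ext d z -> z != 0 -> derivable h z 1.
  move=> Kz z0; apply: holoM; first exact: Fd.
  apply: holoM; first exact: derivable_power_gap.
  apply: holoV; first by apply: holoX; exact: holo_id.
  by rewrite expf_neq0.
have [B0 [B00 KB]] : exists B : R, 0 < B /\ forall z, lemniscate_ext d z -> abs z <= B.
  by have [B ? ?] := compact_bounded (lemniscate_ext_compact d0); exists B.
have cK : continuous (fun z => d * abs z ^+ n) by exact: continuous_scaled_modulus.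
have cD : continuous (fun z => abs (power_gap z)).
  by apply: continuous_modulus_comp => z; exact: derivable_power_gap.
have [r [r0 rK]] : exists r, 0 < r /\ forall z, abs z < r -> lemniscate_ext d z.
  have : nbhs (0 : C) [set z | d * abs z ^+ n - abs (power_gap z) < 0].
    have cc : {for (0 : C), continuous (fun z => d * abs z ^+ n - abs (power_gap z))}.
      exact: (cvgB (cK 0) (cD 0)).
    have neg : d * abs 0 ^+ n - abs (power_gap 0) < 0.
      by rewrite /power_gap modulus0 addr0 expr1n !expr0n eqn0Ngt n0 mulr0 subr0 modulus1 subr_lt0.
    by apply: (cc [set x | x < 0]); apply: open_nbhs_nbhs; split; [exact: open_lt|exact: neg].
  move=> /nbhsCP[r r0 rP]; exists r; split => // z zr; apply/ltW.
  by rewrite -subr_lt0; apply: rP; rewrite subr0.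
have [B [r' [r'0 FB]]] : exists B r' : R, 0 < r' /\
    forall z, abs z < r' -> abs (\sum_(j < n) f (root_rotation j z)) <= B * abs z ^+ n.
  by apply: (symmetric_mean_order r0) => // z zr; apply: fd; exact: rK.
pose U := [set z | z != 0] `&` [set z | d * abs z ^+ n < abs (power_gap z)].
have oU : open U.
  apply: openI.
    rewrite (_ : [set z | z != 0] = ~` [set 0]); last first.
      by apply/seteqP; split => z /= => [/eqP|/eqP].
    apply/openCP => z /= z0; exists (abs z).
      by rewrite modulus_gt0; apply/eqP.
    by move=> v /[swap] ->; rewrite sub0r modulusN ltxx.
  rewrite (_ : [set z | _] = (fun z => d * abs z ^+ n - abs (power_gap z)) @^-1` [set x | x < 0]).
    apply: open_comp; last exact: open_lt.
    move=> z _; exact: (cvgB (cK z) (cD z)).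
  by apply/seteqP; split => z /=; rewrite subr_lt0.
have UK : U `<=` lemniscate_ext d by move=> z [_ /= /ltW].
have Kpos z : lemniscate_ext d z -> ~ U z -> z != 0 -> abs (power_gap z) = d * abs z ^+ n.
  move=> Kz nU z0; apply/le_anti; rewrite [X in _ && X]Kz andbT leNgt.
  by apply/negP => lt; apply: nU.
have D1 : power_gap (-1) = - (-1) ^+ n.
  by rewrite /power_gap (subrr (1 : C)) expr0n eqn0Ngt n0 (sub0r ((-1 : C) ^+ n)).
have K1 : lemniscate_ext d (-1).
  have : d * abs (-1) ^+ n <= abs (power_gap (-1)); last by [].
  by rewrite D1 !modulusN modulusX !modulusN modulus1 !expr1n mulr1.
have main k : abs (f (-1)) ^+ k <= B0 * d ^+ k.
  pose H (z : C) : C := z * h z ^+ k.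
  have Hd z : lemniscate_ext d z -> z != 0 -> derivable H z 1.
    by move=> Kz z0; apply: holoM; [exact: holo_id|apply: holoX; exact: hd].
  have H0 : H 0 = 0 by rewrite /H mul0r.
  have Hc z : lemniscate_ext d z -> {for z, continuous H}.
    move=> Kz; have [z0|z0] := eqVneq z 0; last first.
      by apply: derivable_continuous; exact: Hd.
    rewrite {z Kz}z0; apply/continuousCP => e e0; rewrite H0.
    pose A := `|B| * (2 ^+ n + 1).
    have A0 : 0 <= A by rewrite mulr_ge0 // addr_ge0 // exprn_ge0.
    have Ak : 0 < A ^+ k + 1 by rewrite ltr_wpDl // exprn_ge0.
    have hA v : abs v < r' -> abs v < 1 -> abs (h v) <= A.
      move=> vr v1; rewrite /h /F; have [->|v0] := eqVneq v 0.
        by rewrite expr0n eqn0Ngt n0 invr0 !mulr0 modulus0.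
      have vn0 : 0 < abs v ^+ n by rewrite exprn_gt0 // modulus_gt0.
      have nn : abs (n%:R : C) = n%:R.
        by rewrite -(rmorph_nat (real_complex R)) modulusC ger0_norm.
      have DA : abs (power_gap v) <= 2 ^+ n + 1.
        rewrite /power_gap; apply: (le_trans (modulusD _ _)); rewrite modulusN !modulusX.
        have v11 : abs (1 + v) <= 2.
          by apply: (le_trans (modulusD _ _)); rewrite modulus1; lra.
        apply: lerD; first by apply: lerXn2r => //; rewrite nnegrE ?modulus_ge0.
        by rewrite exprn_ile1 ?modulus_ge0 // ltW.
      have nR : 0 < n%:R :> R by rewrite ltr0n.
      rewrite !modulusM !modulusV modulusX nn.
      rewrite (_ : _ * _ = abs (\sum_(j < n) f (root_rotation j v)) / (n%:R * abs v ^+ n) * abs (power_gap v)); last first.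
        by field; rewrite (lt0r_neq0 nR) (lt0r_neq0 vn0).
      apply: ler_pM; [|exact: modulus_ge0| |exact: DA].
        by rewrite divr_ge0 ?modulus_ge0 // mulr_ge0 // ltW.
      rewrite ler_pdivrMr ?mulr_gt0 //; apply: (le_trans (FB v vr)).
      rewrite mulrA ler_pM2r //; apply: (le_trans (ler_norm B)).
      by rewrite ler_peMr // ler1n.
    exists (Num.min (Num.min r' 1) (e / (A ^+ k + 1))).
      by rewrite !lt_min r'0 ltr01 divr_gt0.
    move=> v; rewrite !lt_min => /andP[/andP[v1 v2] v3].
    rewrite subr0 in v1 v2 v3; rewrite subr0 /H modulusM modulusX.
    move: v3; rewrite ltr_pdivlMr //; apply: le_lt_trans.
    apply: ler_wpM2l; first exact: modulus_ge0.
    apply: (@le_trans _ _ (A ^+ k)); last by rewrite lerDl.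
    by apply: lerXn2r; [rewrite nnegrE modulus_ge0|rewrite nnegrE|exact: hA].
  have HM z : lemniscate_ext d z -> ~ U z -> abs (H z) <= B0 * d ^+ k.
    move=> Kz nU; have [->|z0] := eqVneq z 0.
      by rewrite H0 modulus0 mulr_ge0 ?exprn_ge0 ?(ltW B00) ?(ltW d0).
    rewrite /H modulusM modulusX; apply: ler_pM.
    - exact: modulus_ge0.
    - by rewrite exprn_ge0 ?modulus_ge0.
    - exact: KB.
    have zn0 : 0 < abs z ^+ n by rewrite exprn_gt0 // modulus_gt0.
    apply: lerXn2r; [by rewrite nnegrE modulus_ge0|by rewrite nnegrE ltW|].
    rewrite /h (modulusM (F z)) (modulusM (power_gap z)) modulusV modulusX (Kpos z Kz nU z0) mulfK ?gt_eqF //.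
    by rewrite -[leRHS]mul1r ler_wpM2r ?F1 // ltW.
  have := maximum_principle (lemniscate_ext_compact d0) oU UK _ Hc _ HM.
  have -> : abs (f (-1)) ^+ k = abs (H (-1)).
    rewrite /H modulusM modulusN modulus1 mul1r modulusX; congr (_ ^+ k).
    rewrite /h /F (eq_bigr (fun=> f (-1))); last first.
      move=> j _; congr f; rewrite /root_rotation subrr mulrN1 sub0r opprK mulNr divff //.
      by rewrite -modulus_gt0 root_modulus.
    rewrite sumr_const card_ord -[f (-1) *+ n]mulr_natl mulKf //.
    rewrite D1 mulNr divff ?mulrN1 ?modulusN //.
    by rewrite expf_neq0 // oppr_eq0 oner_neq0.
  apply.
  - by rewrite mulr_ge0 ?exprn_ge0 ?(ltW B00) ?(ltW d0).
  - by move=> z Uz; apply: Hd; [exact: UK|case: Uz].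
  - exact: K1.
exact: (le_of_pow_le (modulus_ge0 _) d0 main).
Qed.

End upper.

(** * Generalities on the Moebius distance *)

Section mobius.
Variable R : realType.
Local Notation C := (R[i]^o).
Local Notation abs := (@modulus R).
Implicit Types (Omega : set C) (z : C) (t : R).

Lemma mobius_ubound Omega z z0 : Omega z -> ubound
  [set abs (f z) | f in [set f | hol_to_disk Omega f /\ f z0 = 0]] 1.
Proof. by move=> Oz _ [f [[_ f1] _] <-]; apply/ltW; exact: f1. Qed.

Lemma mobius_nonempty Omega z z0 :
  [set abs (f z) | f in [set f | hol_to_disk Omega f /\ f z0 = 0]] !=set0.
Proof.
exists (abs 0), (fun=> 0) => //; split => //; split.
  by move=> v _; exact: holo_cst.
by move=> v _; rewrite modulus0.
Qed.

Lemma mobius_ge Omega z z0 f : Omega z -> hol_to_disk Omega f -> f z0 = 0 ->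
  abs (f z) <= mobius_dist Omega z z0.
Proof.
move=> Oz fO f0; apply: ub_le_sup; last by exists f.
by exists 1; exact: mobius_ubound.
Qed.

Lemma mobius_le Omega z z0 t :
  (forall f, hol_to_disk Omega f -> f z0 = 0 -> abs (f z) <= t) ->
  mobius_dist Omega z z0 <= t.
Proof.
move=> H; apply: ge_sup; first exact: mobius_nonempty.
by move=> _ [f [fO f0] <-]; exact: H.
Qed.

Lemma mobius_ge0 Omega z z0 : Omega z -> 0 <= mobius_dist Omega z z0.
Proof.
move=> Oz; rewrite -(@modulus0 R); apply: (@mobius_ge _ _ _ (fun=> 0)) => //.
split; first by move=> v _; exact: holo_cst.
by move=> v _; rewrite modulus0.
Qed.

Lemma mobius_refl Omega z : Omega z -> mobius_dist Omega z z = 0.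
Proof.
move=> Oz; apply/le_anti; rewrite mobius_ge0 // andbT.
by apply: mobius_le => f _ ->; rewrite modulus0.
Qed.

(** A supremum of continuous functions is lower semicontinuous. *)
Lemma mobius_lsc Omega z z0 (A : set C) t : Omega z -> closure A z ->
  (forall v, A v -> Omega v /\ mobius_dist Omega v z0 <= t) ->
  mobius_dist Omega z z0 <= t.
Proof.
move=> Oz cAz At; apply: mobius_le => f fO f0; rewrite leNgt; apply/negP => ft.
have cf : {for z, continuous (fun v => abs (f v))}.
  apply: (@continuous_comp _ _ _ f abs); last exact: continuous_modulus.
  by apply: derivable_continuous; apply: fO.1.
have : nbhs z [set v | t < abs (f v)].
  apply: (cf [set x | t < x]); apply: open_nbhs_nbhs; split => //; exact: open_gt.
move=> /cAz[v [Av /= tv]]; have [Ov vt] := At v Av.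
by have := le_trans (mobius_ge Ov fO f0) vt; rewrite leNgt tv.
Qed.

Lemma lsc_attains_min (K : set C) (phi : C -> R) : compact K -> K !=set0 ->
  (forall z, K z -> 0 <= phi z) ->
  (forall t z, closure (K `&` [set v | phi v <= t]) z -> phi z <= t) ->
  exists2 m, K m & forall z, K z -> phi m <= phi z.
Proof.
move=> cK K0 phi0 lsc.
pose m := inf (phi @` K).
have hm : has_inf (phi @` K).
  split; first by have [z Kz] := K0; exists (phi z), z.
  by exists 0 => _ [z Kz <-]; exact: phi0.
(* by compactness the sublevel sets above the infimum have a common point *)
pose F := filter_from [set t | m < t] (fun t => K `&` [set v | phi v <= t]).
have FF : ProperFilter F.
  apply: filter_from_proper; last first.
    move=> t mt; have e0 : 0 < t - m by rewrite subr_gt0.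
    have [_ [z Kz <-] zt] := inf_adherent e0 hm.
    by exists z; split => //=; apply/ltW; move: zt; rewrite -/m addrC subrK.
  apply: filter_from_filter; first by exists (m + 1); rewrite /= ltrDl.
  move=> s t ms mt; exists (Num.min s t); first by rewrite /= lt_min ms.
  by move=> z [Kz /=]; rewrite le_min => /andP[zs zt]; split.
have FK : F K by exists (m + 1); [rewrite /= ltrDl|move=> z []].
have [z [Kz clz]] := cK F FF FK.
exists z => // v Kv; apply: (@le_trans _ _ m); last first.
  by apply: ge_inf; [case: hm|exists v].
apply/ler_addgt0Pr => e e0; apply: lsc => V Vz.
have : F (K `&` [set v | phi v <= m + e]) by exists (m + e); rewrite //= ltrDl.
by move=> /clz /(_ Vz).
Qed.

Lemma artanh_lt (x y : R) : 0 <= x -> 0 <= y < 1 ->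
  (artanh x < (ln ((1 + y) / (1 - y)) / 2)%:E)%E = (x < y).
Proof.
move=> x0 /andP[y0 y1]; rewrite /artanh; case: ifPn => [x1|]; last first.
  rewrite -leNgt => x1; apply/esym/negbTE; rewrite -leNgt.
  exact: ltW (lt_le_trans y1 x1).
rewrite lte_fin ltr_pM2r ?invr_gt0 // ltr_ln ?posrE ?divr_gt0 ?subr_gt0 //; try lra.
rewrite ltr_pdivrMr ?subr_gt0 // mulrAC ltr_pdivlMr ?subr_gt0 //.
by apply/idP/idP; nra.
Qed.

Lemma artanh_le (x y : R) : 0 <= x -> 0 <= y < 1 ->
  (artanh x <= (ln ((1 + y) / (1 - y)) / 2)%:E)%E = (x <= y).
Proof.
move=> x0 /andP[y0 y1]; rewrite /artanh; case: ifPn => [x1|]; last first.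
  rewrite -leNgt => x1; apply/esym/negbTE; rewrite -ltNge.
  exact: lt_le_trans y1 x1.
rewrite lee_fin ler_pM2r ?invr_gt0 // ler_ln ?posrE ?divr_gt0 ?subr_gt0 //; try lra.
rewrite ler_pdivrMr ?subr_gt0 // mulrAC ler_pdivlMr ?subr_gt0 //.
by apply/idP/idP; nra.
Qed.

End mobius.

(** * The circular domain and lower bounds for its Moebius distance *)

Section lower.
Variable R : realType.
Local Notation C := (R[i]^o).
Local Notation abs := (@modulus R).
Variables (n : nat) (w : C).
Hypothesis wn : n.-primitive_root w.

(** In the coordinate zeta = 1 + 1/z this is z (zeta - w^j). *)
Definition root_factor j (z : C) : C := 1 + z - w ^+ j * z.

(** The conditions |zeta - w^j| > e, multiplied by |z|.  For j = 0 the factor is 1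
    and the condition is |z| < 1/e. *)
Definition circ_domain (e : R) : set C := [set z | forall j : 'I_n, e * abs z < abs (root_factor j z)].

Lemma derivable_root_factor j z : derivable (root_factor j) z 1.
Proof.
apply: holoB; first by apply: holoD; [exact: holo_cst|exact: holo_id].
by apply: holoM; [exact: holo_cst|exact: holo_id].
Qed.

Lemma root_factor_neq0 (e : R) z (j : 'I_n) : 0 < e -> circ_domain e z -> root_factor j z != 0.
Proof.
move=> e0 /(_ j) h; rewrite -modulus_gt0; apply: le_lt_trans h.
by rewrite mulr_ge0 ?modulus_ge0 // ltW.
Qed.

Lemma circ_domain0 (e : R) : circ_domain e 0.
Proof. by move=> j; rewrite /root_factor mulr0 addr0 subr0 modulus0 mulr0 modulus1. Qed.

Lemma roots_separated : exists2 d : R, 0 < d &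
  forall i j : 'I_n, i != j -> d <= abs (w ^+ i - w ^+ j).
Proof.
have main (s : seq ('I_n * 'I_n)) : exists2 d : R, 0 < d &
    forall ij, ij \in s -> ij.1 != ij.2 -> d <= abs (w ^+ ij.1 - w ^+ ij.2).
  elim: s => [|[i j] s [d d0 IH]]; first by exists 1.
  have [ij|ij] := eqVneq i j.
    exists d => // kl; rewrite inE => /orP[/eqP -> /=|]; last exact: IH.
    by rewrite ij eqxx.
  have wij : 0 < abs (w ^+ i - w ^+ j).
    by rewrite modulus_gt0 subr_eq0 (eq_prim_root_expr wn) !modn_small.
  exists (Num.min d (abs (w ^+ i - w ^+ j))); first by rewrite lt_min d0.
  move=> kl; rewrite inE => /orP[/eqP -> _ /=|ks kl0]; rewrite ge_min ?lexx ?orbT //.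
  by rewrite IH.
have [d d0 dP] := main (enum {: 'I_n * 'I_n}).
by exists d => // i j ij; apply: (dP (i, j)); rewrite ?mem_enum.
Qed.

Variables (d e : R).
Hypotheses (d0 : 0 < d) (e0 : 0 < e).
Hypothesis dP : forall i j : 'I_n, i != j -> d <= abs (w ^+ i - w ^+ j).

Lemma root_factor_sep (i j : 'I_n) z : i != j -> d * abs z <= abs (root_factor i z) + abs (root_factor j z).
Proof.
move=> ij; apply: (@le_trans _ _ (abs (root_factor j z - root_factor i z))).
  rewrite (_ : root_factor j z - root_factor i z = (w ^+ i - w ^+ j) * z); last by rewrite /root_factor; ring.
  by rewrite modulusM ler_wpM2r ?modulus_ge0 ?dP.
by rewrite addrC -(modulusN (root_factor i z)) modulusD.
Qed.

(** The sum of the 1 / |zeta - w^j|. *)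
Definition inv_dist_sum (z : C) : R := \sum_(j < n) abs z / abs (root_factor j z).

(** At most one of the roots of unity is closer to zeta than d/2.  Its term is at
    most 1/e and each of the other terms is at most 2/d. *)
Lemma inv_dist_sum_bound z : circ_domain e z -> e * inv_dist_sum z <= 1 + e * (2 * n%:R / d).
Proof.
move=> Oz; have den0 (j : 'I_n) : 0 < abs (root_factor j z).
  by rewrite modulus_gt0; exact: root_factor_neq0 Oz.
have [[i hi]|hN] := pselect (exists i : 'I_n, 2 * abs (root_factor i z) < d * abs z).
  apply: (@le_trans _ _ (\sum_(j < n) ((j == i)%:R + e * (2 / d)))); last first.
    rewrite big_split /= sumr_const card_ord.
    rewrite (bigD1 i) //= eqxx big1 ?addr0; last by move=> j /negbTE ->.
    by rewrite -[_ *+ n]mulr_natr (_ : e * (2 * n%:R / d) = e * (2 / d) * n%:R) //; ring.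
  rewrite /inv_dist_sum mulr_sumr; apply: ler_sum => j _; have [->|ji] := eqVneq j i.
    apply: (@le_trans _ _ 1); last by rewrite lerDl mulr_ge0 ?divr_ge0 // ltW.
    by rewrite mulrA ler_pdivrMr // mul1r ltW.
  rewrite add0r ler_pM2l // ler_pdivrMr // mulrAC ler_pdivlMr //.
  by have := root_factor_sep z ji; lra.
have {}hN (i : 'I_n) : d * abs z <= 2 * abs (root_factor i z).
  by rewrite leNgt; apply/negP => h; apply: hN; exists i.
apply: (@le_trans _ _ (\sum_(j < n) (e * (2 / d)))); last first.
  rewrite sumr_const card_ord -[_ *+ n]mulr_natr.
  by rewrite (_ : e * (2 * n%:R / d) = e * (2 / d) * n%:R) ?lerDr //; ring.
rewrite /inv_dist_sum mulr_sumr; apply: ler_sum => j _.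
by rewrite ler_pM2l // ler_pdivrMr // mulrAC ler_pdivlMr // mulrC hN.
Qed.

Definition sum_cst : R := 1 + e * (2 * n%:R / d + 1).

Lemma sum_cst_gt0 : 0 < sum_cst.
Proof.
by rewrite /sum_cst ltr_wpDr // mulr_ge0 ?(ltW e0) // addr_ge0 // divr_ge0 ?(ltW d0) // mulr_ge0.
Qed.

(** Given z, the unimodular coefficients of the sum of the
    a_j e / (zeta - w^j) are chosen so that all terms are positive at z. *)
Theorem mobius_dist_ge_sum z : circ_domain e z -> e / sum_cst * inv_dist_sum z <= mobius_dist (circ_domain e) z 0.
Proof.
move=> Oz.
(* of modulus 1, or 0 when z = 0 *)
pose al (j : 'I_n) : C := (abs (z / root_factor j z))%:C / (z / root_factor j z).
have al1 j : abs (al j) <= 1.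
  rewrite /al; move: (z / root_factor j z) => v.
  rewrite (modulusM (abs v)%:C) modulusV modulusC ger0_norm ?modulus_ge0 //.
  have [->|h] := eqVneq (abs v) 0; first by rewrite mul0r.
  by rewrite divff.
have sum_cst0 := sum_cst_gt0.
pose f (v : C) : C := (e / sum_cst)%:C * \sum_(j < n) al j * (v / root_factor j v).
have fO : hol_to_disk (circ_domain e) f.
  split=> v Ov.
    apply: holoM; first exact: holo_cst.
    apply: holo_sum => j; apply: holoM; first exact: holo_cst.
    apply: holoM; first exact: holo_id.
    by apply: holoV; [exact: derivable_root_factor|exact: root_factor_neq0 Ov].
  rewrite /f modulusM modulusC ger0_norm; last by rewrite divr_ge0 ?(ltW e0) ?(ltW sum_cst0).
  apply: (@le_lt_trans _ _ (e / sum_cst * inv_dist_sum v)).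
    apply: ler_wpM2l; first by rewrite divr_ge0 ?(ltW e0) ?(ltW sum_cst0).
    apply: (le_trans (modulus_sum _ _ _)); apply: ler_sum => j _.
    by rewrite (modulusM (al j)) (modulusM v) modulusV ler_piMl ?divr_ge0 ?modulus_ge0.
  rewrite mulrAC ltr_pdivrMr // mul1r; apply: (le_lt_trans (inv_dist_sum_bound Ov)).
  by rewrite /sum_cst mulrDr mulr1 addrA ltrDl.
have f0 : f 0 = 0.
  by rewrite /f big1 ?mulr0 // => j _; rewrite mul0r mulr0.
have -> : e / sum_cst * inv_dist_sum z = abs (f z); last exact: mobius_ge.
rewrite /f (_ : \sum_(j < n) _ = (inv_dist_sum z)%:C).
  rewrite -rmorphM modulusC ger0_norm // mulr_ge0 ?divr_ge0 ?(ltW e0) ?(ltW sum_cst0) //.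
  by apply: sumr_ge0 => j _; rewrite divr_ge0 ?modulus_ge0.
rewrite /inv_dist_sum rmorph_sum /=; apply: eq_bigr => j _; rewrite /al.
have [->|z0] := eqVneq z 0; first by rewrite !(mul0r, mulr0, modulus0).
have dz : root_factor j z != 0 by exact: root_factor_neq0 Oz.
rewrite divfK ?mulf_neq0 ?invr_eq0 //.
by rewrite modulusM modulusV.
Qed.

(** The Taylor polynomial of (1 - t)^(-1/2) is 1 + t/2 + 3/8 t^2 + ...; lowering
    the coefficient 3/8 to 5/16 leaves room for the cubic term. *)
Lemma inv_sqrt_lower (s t : R) : 0 < s -> s ^+ 2 = 1 - t -> - (1 / 5) <= t <= 1 / 5 ->
  1 + t / 2 + 5 / 16 * t ^+ 2 <= s^-1.
Proof.
move=> s0 st /andP[t1 t2].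
set q := 1 + _ + _; have q0 : 0 < q by rewrite /q; nra.
rewrite -[q]invrK lef_pV2 ?posrE ?invr_gt0 //.
rewrite -(@ler_pXn2r _ 2) ?nnegrE ?invr_ge0 ?(ltW s0) ?(ltW q0) // st exprVn.
rewrite -[leRHS]mul1r ler_pdivlMr ?exprn_gt0 // /q.
have : 0 <= t ^+ 2 * (1 / 8 + 9 / 16 * t + 55 / 256 * t ^+ 2 + 25 / 256 * t ^+ 3).
  apply: mulr_ge0; first exact: sqr_ge0.
  have : 0 <= t ^+ 2 by exact: sqr_ge0.
  have : - (1 / 5) * t ^+ 2 <= t ^+ 3 by rewrite exprS; nra.
  lra.
lra.
Qed.

End lower.

(** * The potential of charges at the roots of unity *)

Section barrier.
Variable R : realType.
Local Notation C := (R[i]^o).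
Local Notation abs := (@modulus R).
Local Notation Re := (@complex.Re R).
Variables (n : nat) (w : C).
Hypothesis wn : n.-primitive_root w.

Let n0 : (0 < n)%N. Proof. exact: prim_order_gt0 wn. Qed.

Lemma Re_sum (F : 'I_n -> C) : Re (\sum_(j < n) F j) = \sum_(j < n) Re (F j).
Proof. by apply: (big_morph Re (@ReD R)). Qed.

Lemma sum_Re_rot (z : C) k : (0 < k < n)%N ->
  \sum_(j < n) Re ((z * conjc (w ^+ j)) ^+ k) = 0.
Proof.
move=> kn; rewrite -Re_sum.
rewrite (eq_bigr (fun j : 'I_n => z ^+ k * conjc ((w ^+ j) ^+ k))); last first.
  by move=> j _; rewrite exprMn [conjc (_ ^+ k)]rmorphXn.
by rewrite -mulr_sumr -(rmorph_sum (@conjc R)) (sum_root_pow wn kn) rmorph0 mulr0.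
Qed.

Lemma dist_root_sqr (z : C) j :
  abs (z - w ^+ j) ^+ 2 = 1 - (2 * Re (z * conjc (w ^+ j)) - abs z ^+ 2).
Proof.
have := root_modulus wn j; move: (w ^+ j) => p p1.
have : abs p ^+ 2 = 1 by rewrite p1 expr1n.
by rewrite !modulus_sqr; case: z p {p1} => [x y] [u v] /= h; lra.
Qed.

Lemma Re_sqr (u : C) : Re u ^+ 2 = (abs u ^+ 2 + Re (u ^+ 2)) / 2.
Proof. by rewrite modulus_sqr expr2; case: u => [x y] /=; lra. Qed.

(** Write |z - w^j|^2 = 1 - t_j with t_j = 2 x_j - r^2 and
    x_j = Re (z conj(w^j)).  The sum of the x_j is 0 and, since n > 2, the sum of
    the x_j^2 is n r^2 / 2, so [inv_sqrt_lower] gives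
    n (1 - r^2/2 + 5/8 r^2 + 5/16 r^4). *)
Lemma sum_inv_dist (z : C) (r : R) : (2 < n)%N -> abs z = r -> r <= 1 / 12 ->
  n%:R * (1 + r ^+ 2 / 8) <= \sum_(j < n) (abs (z - w ^+ j))^-1.
Proof.
move=> n2 zr r12; have r0 : 0 <= r by rewrite -zr modulus_ge0.
pose x (j : 'I_n) := Re (z * conjc (w ^+ j)).
have uj (j : 'I_n) : abs (z * conjc (w ^+ j)) = r.
  rewrite modulusM zr; have -> : abs (conjc (w ^+ j)) = abs (w ^+ j).
    by case: (w ^+ j) => u v; rewrite /modulus /= sqrrN.
  by rewrite (root_modulus wn) mulr1.
have xr j : `|x j| <= r by rewrite -(uj j); exact: Re_modulus.
have sx : \sum_(j < n) x j = 0.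
  by rewrite -[RHS](@sum_Re_rot z 1) ?(ltn_trans _ n2) //; apply: eq_bigr => j _; rewrite expr1.
have sx2 : \sum_(j < n) x j ^+ 2 = n%:R * (r ^+ 2 / 2).
  rewrite (eq_bigr (fun j : 'I_n => r ^+ 2 / 2 + 2^-1 * Re ((z * conjc (w ^+ j)) ^+ 2))).
    rewrite big_split /= sumr_const card_ord -mulr_sumr sum_Re_rot // mulr0 addr0.
    by rewrite -[_ *+ n]mulr_natl.
  by move=> j _; rewrite Re_sqr uj; ring.
pose t j := 2 * x j - r ^+ 2.
have r2 : r ^+ 2 <= 1 / 144.
  rewrite (_ : 1 / 144 = (1 / 12) ^+ 2); last by field.
  by apply: lerXn2r; rewrite ?nnegrE //; lra.
have r20 : 0 <= r ^+ 2 by exact: sqr_ge0.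
apply: (@le_trans _ _ (\sum_(j < n) (1 + t j / 2 + 5 / 16 * t j ^+ 2))).
  rewrite (eq_bigr (fun j => (1 - r ^+ 2 / 2 + 5 / 16 * r ^+ 4) +
     (1 - 5 / 4 * r ^+ 2) * x j + 5 / 4 * x j ^+ 2)); last first.
    by move=> j _; rewrite /t; field.
  have lin (c0 c1 c2 : R) : \sum_(j < n) (c0 + c1 * x j + c2 * x j ^+ 2) =
      n%:R * (c0 + c2 * (r ^+ 2 / 2)).
    rewrite !big_split /= -!mulr_sumr sx sx2 sumr_const card_ord -[_ *+ n]mulr_natl.
    by ring.
  rewrite lin ler_pM2l ?ltr0n //.
  have : 0 <= r ^+ 4 by exact: exprn_ge0.
  lra.
apply: ler_sum => j _; apply: inv_sqrt_lower.
- rewrite modulus_gt0 subr_eq0; apply/eqP => zw.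
  by move: r12; rewrite -zr zw (root_modulus wn); lra.
- by rewrite dist_root_sqr zr.
- have := xr j; rewrite ler_norml /t => /andP[h1 h2]; lra.
Qed.

Lemma inv_dist_sum_barrier (z : C) (r : R) : (2 < n)%N -> z != 0 -> abs (1 + z) = r * abs z ->
  r <= 1 / 12 -> n%:R * (1 + r ^+ 2 / 8) <= inv_dist_sum n w z.
Proof.
move=> n2 z0 zr r12; have az0 : abs z != 0 by rewrite modulus_eq0.
have := @sum_inv_dist ((1 + z) / z) r n2; rewrite modulusM modulusV zr mulfK // => /(_ erefl r12).
move=> /le_trans; apply; apply: ler_sum => j _.
rewrite (_ : (1 + z) / z - w ^+ j = root_factor w j z / z); last by rewrite /root_factor; field.
by rewrite modulusM modulusV invfM invrK mulrC.
Qed.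

(** If |zeta - w^j| <= e, then |zeta^n - 1| <= n e (1 + e)^(n-1). *)
Lemma lemniscate_ext_sub (e dl : R) : 0 < e -> n%:R * e * (1 + e) ^+ n.-1 < dl ->
  lemniscate_ext n dl `<=` circ_domain n w e.
Proof.
move=> e0 edl z Kz j; rewrite ltNge; apply/negP => h.
have z0 : z != 0.
  apply/eqP => z0; move: h; rewrite z0 /root_factor mulr0 addr0 subr0 modulus0 modulus1 mulr0.
  by rewrite ler10.
have az0 : 0 < abs z by rewrite modulus_gt0.
set a := 1 + z; set b := w ^+ j * z.
have bz : abs b = abs z by rewrite modulusM (root_modulus wn) mul1r.
have ab : abs (a - b) <= e * abs z by [].
have az : abs a <= (1 + e) * abs z.
  rewrite -(subrK b a); apply: (le_trans (modulusD _ _)); rewrite bz; lra.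
have Db : power_gap n z = a ^+ n - b ^+ n.
  by rewrite /power_gap /b exprMn -exprM mulnC exprM (prim_expr_order wn) expr1n mul1r.
have : abs (power_gap n z) <= e * abs z * (n%:R * ((1 + e) * abs z) ^+ n.-1).
  rewrite Db subrXX modulusM; apply: ler_pM; rewrite ?modulus_ge0 //.
  apply: (le_trans (modulus_sum _ _ _)).
  apply: (@le_trans _ _ (\sum_(i < n) ((1 + e) * abs z) ^+ n.-1)); last first.
    by rewrite sumr_const card_ord -[_ *+ n]mulr_natl.
  apply: ler_sum => i _; rewrite modulusM !modulusX bz.
  have in1 : (n.-1 = (n.-1 - i) + i)%N by have := ltn_ord i; lia.
  rewrite [X in _ <= _ ^+ X]in1 exprD; apply: ler_pM; rewrite ?exprn_ge0 ?modulus_ge0 //.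
    by apply: lerXn2r; rewrite ?nnegrE ?modulus_ge0 // mulr_ge0 ?modulus_ge0 //; lra.
  by apply: lerXn2r; rewrite ?nnegrE ?mulr_ge0 ?modulus_ge0 //; nra.
move=> /(le_trans Kz); apply/negP; rewrite -ltNge.
rewrite (_ : e * _ * _ = n%:R * e * (1 + e) ^+ n.-1 * abs z ^+ n); last first.
  rewrite exprMn (_ : abs z ^+ n = abs z * abs z ^+ n.-1); last by rewrite -exprS prednK.
  by ring.
by rewrite ltr_pM2r // exprn_gt0.
Qed.

Theorem mobius_center_le (e dl : R) : 0 < e -> n%:R * e * (1 + e) ^+ n.-1 < dl ->
  dl <= 1 -> mobius_dist (circ_domain n w e) (-1) 0 <= dl.
Proof.
move=> e0 edl dl1; have KO := lemniscate_ext_sub e0 edl.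
have dl0 : 0 < dl.
  apply: le_lt_trans edl; rewrite mulr_ge0 ?exprn_ge0 ?mulr_ge0 ?(ltW e0) //; lra.
apply: mobius_le => f [fd f1] f0; apply: (symmetric_upper_bound wn) => //.
- by rewrite dl0.
- by move=> z /KO; exact: fd.
- by move=> z /KO/f1/ltW.
Qed.

(** The induction step is (1 + e) (1 - (m + 1) e) <= 1 - m e. *)
Lemma bernoulli_upper (e : R) m : 0 <= e -> (1 + e) ^+ m * (1 - m%:R * e) <= 1.
Proof.
move=> e0; elim: m => [|m IH]; first by rewrite expr0 mul0r subr0 mul1r.
apply: le_trans IH; rewrite exprSr -mulrA; apply: ler_wpM2l.
  by rewrite exprn_ge0 //; lra.
rewrite -natr1; have m0 : 0 <= m%:R :> R by [].
nra.
Qed.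

(** The distance on the circle |zeta| = 1/12 is at least
    n e (1 + b) / (1 + q e) with b = (1/12)^2 / 8, while at the centre it is at most
    n e (1 + b/3) if n e <= b/4; so e of the order of b / (q + n) suffices.
    The last clause will keep the ball of radius rho in a compact subset. *)
Theorem barrier_gap (d : R) : (2 < n)%N -> 0 < d ->
  (forall i j : 'I_n, i != j -> d <= abs (w ^+ i - w ^+ j)) ->
  exists e : R, [/\ 0 < e, 2 * e < d, e < 1 / 2 &
   exists rho : R, [/\ 0 < rho < 1,
     mobius_dist (circ_domain n w e) (-1) 0 < rho,
     (forall z, circ_domain n w e z -> abs (1 + z) = 1 / 12 * abs z ->
        rho <= mobius_dist (circ_domain n w e) z 0) &
     exists2 k : R, 0 < k < 1 &
       forall z, circ_domain n w e z -> mobius_dist (circ_domain n w e) z 0 < rho ->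
       forall j : 'I_n, e * abs z <= k * abs (root_factor w j z)]].
Proof.
move=> n2 d0 dP; have N0 : 0 < n%:R :> R by rewrite ltr0n.
have N3 : 3 <= n%:R :> R by rewrite ler_nat.
pose q := 2 * n%:R / d + 1.
have qd : 0 < n%:R / d by rewrite divr_gt0.
have q1 : 1 <= q by rewrite /q -mulrA; lra.
have [b [bE b0 b1]] : exists b : R, [/\ b = (1 / 12) ^+ 2 / 8, 0 < b & b <= 1 / 100].
  by exists ((1 / 12) ^+ 2 / 8); split; rewrite // expr2; lra.
pose e : R := b / 4 / (q + n%:R).
have qn0 : 0 < q + n%:R by lra.
have e0 : 0 < e by rewrite /e !divr_gt0.
have eq' : e * q + e * n%:R = b / 4 by rewrite -mulrDr /e divfK // gt_eqF.
have en : 0 < e * n%:R by rewrite mulr_gt0.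
have eq0 : 0 < e * q by rewrite mulr_gt0 //; lra.
have en5 : e * n%:R <= b / 4 by lra.
have eq5 : e * q <= b / 4 by lra.
have sum_cst1 : sum_cst n d e = 1 + e * q by [].
have sum_cst0 : 0 < sum_cst n d e by rewrite sum_cst1; lra.
have d2e : 2 * e < d.
  have : e * (2 * n%:R / d) <= b / 4 by rewrite /q mulrDr in eq5; lra.
  by rewrite mulrA ler_pdivrMr //; nra.
pose rho := e * n%:R * (1 + b) / sum_cst n d e.
have rhoA : rho * sum_cst n d e = e * n%:R * (1 + b) by rewrite /rho divfK // gt_eqF.
have rho0 : 0 < rho by rewrite divr_gt0 // mulr_gt0 //; lra.
have bb : b * b <= b * (1 / 100) by rewrite ler_pM2l.
have enb : e * n%:R * b <= e * n%:R by rewrite ler_piMr ?(ltW en) //; lra.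
have rho1 : rho < 1 by rewrite ltr_pdivrMr // mul1r sum_cst1; lra.
have e12 : e < 1 / 2.
  have : e * 3 <= e * n%:R by rewrite ler_pM2l.
  lra.
exists e; split => //.
exists rho; split; first by rewrite rho0.
- pose dl := e * n%:R * (1 + b / 3).
  apply: (@le_lt_trans _ _ dl); last first.
    rewrite /rho ltr_pdivlMr // sum_cst1 /dl -[ltLHS]mulrA ltr_pM2l //.
    have : (1 + b / 3) * (e * q) <= (1 + b / 3) * (b / 4) by apply: ler_wpM2l => //; lra.
    lra.
  apply: mobius_center_le => //; last by rewrite /dl; lra.
  rewrite /dl [n%:R * e]mulrC ltr_pM2l //.
  have := @bernoulli_upper e n.-1 (ltW e0).
  have nn : n.-1%:R * e <= b / 4.
    apply: le_trans en5; rewrite mulrC ler_pM2l // ler_nat; exact: leq_pred.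
  have : 0 <= (1 + e) ^+ n.-1 by rewrite exprn_ge0 //; lra.
  move: ((1 + e) ^+ n.-1) (n.-1%:R * e) nn => x u ub x0 xu.
  rewrite ltNge; apply/negP => bx.
  have h1 : x * (1 - b / 4) <= x * (1 - u) by apply: ler_wpM2l => //; lra.
  have h2 : (1 + b / 3) * (1 - b / 4) <= x * (1 - b / 4) by apply: ler_wpM2r => //; lra.
  lra.
- move=> z Oz zb; apply: le_trans (mobius_dist_ge_sum d0 e0 dP Oz).
  have z0 : z != 0.
    apply/eqP => z0; move: zb; rewrite z0 addr0 modulus1 modulus0 mulr0 => /eqP.
    by rewrite oner_eq0.
  have := inv_dist_sum_barrier n2 z0 zb (lexx _) => Sz.
  rewrite /rho [leRHS]mulrAC ler_pM2r ?invr_gt0 // -[leLHS]mulrA ler_pM2l //.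
  apply: le_trans Sz; rewrite ler_pM2l // lerD2l.
  by rewrite bE.
- exists (rho * sum_cst n d e); first by rewrite rhoA; apply/andP; split; [rewrite mulr_gt0 //|]; lra.
  move=> z Oz zr j; have dj : 0 < abs (root_factor w j z).
    by rewrite modulus_gt0; exact: root_factor_neq0 Oz.
  have := le_trans (mobius_dist_ge_sum d0 e0 dP Oz) (ltW zr).
  rewrite mulrAC ler_pdivrMr // => h.
  rewrite -ler_pdivrMr // -mulrA; apply: le_trans h; rewrite ler_pM2l //.
  rewrite /inv_dist_sum (bigD1 j) //= lerDl; apply: sumr_ge0 => i _.
  by rewrite divr_ge0 ?modulus_ge0.
Qed.

End barrier.

(** * Connected sets of the plane and connected components *)

Section components_family.
Variable T : topologicalType.

Lemma open_separated (A B : set T) : open A -> open B -> A `&` B = set0 ->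
  separated A B.
Proof.
move=> oA oB AB; split; apply/seteqP; split => x //.
- by move=> [cAx Bx]; have /cAx := open_nbhs_nbhs (conj oB Bx); rewrite AB => -[].
- by move=> [Ax cBx]; have /cBx := open_nbhs_nbhs (conj oA Ax); rewrite setIC AB => -[].
Qed.

Lemma closed_bigcup_ord (E : nat -> set T) n : (forall i, (i < n)%N -> closed (E i)) ->
  forall P : nat -> Prop, closed (\bigcup_(i in [set i | (i < n)%N /\ P i]) E i).
Proof.
elim: n => [|n IH] cE P.
  rewrite (_ : [set i | _] = set0); first by rewrite bigcup_set0; exact: closed0.
  by apply/seteqP; split => i // [].
have IH' := IH (fun i ilt => cE i (ltnW ilt)) P.
have [Pn|nPn] := pselect (P n).
  rewrite (_ : bigcup _ _ = (\bigcup_(i in [set i | (i < n)%N /\ P i]) E i) `|` E n).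
    by apply: closedU => //; exact: cE.
  apply/seteqP; split => x.
    move=> [i [ilt Pi] Ex]; move: ilt; rewrite ltnS leq_eqVlt => /orP[/eqP in_|ilt].
      by right; rewrite -in_.
    by left; exists i.
  by move=> [[i [ilt Pi] Ex]|Ex]; [exists i => //; split => //; exact: ltnW|exists n].
rewrite (_ : bigcup _ _ = (\bigcup_(i in [set i | (i < n)%N /\ P i]) E i)) //.
apply/seteqP; split => x [i [ilt Pi] Ex]; exists i => //; split => //.
  by move: ilt; rewrite ltnS leq_eqVlt => /orP[/eqP in_|//]; rewrite in_ in Pi.
exact: ltnW.
Qed.

(** A connected set that meets E i stays in it, because E i and the union of the
    other sets are separated. *)
Lemma card_components (E : nat -> set T) (n : nat) :
  (forall i, (i < n)%N -> closed (E i)) ->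
  (forall i, (i < n)%N -> connected (E i)) ->
  (forall i, (i < n)%N -> E i !=set0) ->
  (forall i j, (i < n)%N -> (j < n)%N -> i <> j -> E i `&` E j = set0) ->
  (components (\bigcup_(i in `I_n) E i) #= `I_n)%card.
Proof.
move=> cE kE E0 dE; set A := bigcup _ _.
have comp i x : (i < n)%N -> E i x -> connected_component A x = E i.
  move=> ilt Ex; apply/seteqP; split; last first.
    by apply: connected_component_max => //; [move=> y Ey; exists i|exact: kE].
  pose F := \bigcup_(j in [set j | (j < n)%N /\ j <> i]) E j.
  have cF : closed F by exact: closed_bigcup_ord.
  have EF : E i `&` F = set0.
    by apply/seteqP; split => y // [Ey [j [jlt ji] Ejy]]; rewrite -(dE i j) //; exact/nesym.
  have EFs : separated (E i) F.
    have Ecl := (closure_id _).1 (cE i ilt); have Fcl := (closure_id _).1 cF.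
    by rewrite /separated -Ecl -Fcl.
  have sub : connected_component A x `<=` E i `|` F.
    move=> y /connected_component_sub[j jlt Ey].
    by have [ji|ji] := pselect (j = i); [left; rewrite -ji|right; exists j].
  have [//|h] := connected_subset EFs sub (@component_connected _ A x).
  have Ax : A x by exists i.
  have : (E i `&` F) x by split => //; apply: h; exact: connected_component_refl.
  by rewrite EF.
rewrite (_ : components A = E @` `I_n).
  apply: inj_card_eq => i j; rewrite !inE => ilt jlt Eij.
  apply: contrapT => ij; have [x Ex] := E0 i ilt.
  have : (E i `&` E j) x by split => //; rewrite -Eij.
  by rewrite dE.
apply/seteqP; split => B.
  by move=> [x [i ilt Ex] <-]; exists i => //; rewrite (comp i).
by move=> [i ilt <-]; have [x Ex] := E0 i ilt; exists x; [exists i|exact: comp].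
Qed.

End components_family.

Section radial.
Variable R : realType.
Local Notation C := (R[i]^o).
Local Notation abs := (@modulus R).
Implicit Types (c z : C) (r s : R).

Lemma image_connected (f : R -> C) (I : set R) : continuous f -> connected I ->
  connected (f @` I).
Proof.
by move=> cf cI; apply: connected_continuous_connected => //; exact: continuous_subspaceT.
Qed.

(** The rational parametrization of the circle of centre c and radius |k|, up to
    the point c - k. *)
Definition half_turn (k c : C) (t : R) : C := c + k * ((1 +i* t) / (2 - (1 +i* t))).

Lemma half_turn_den (t : R) : 2 - (1 +i* t) != 0 :> C.
Proof.
by apply/eqP => /(congr1 (@complex.Re R)) /=; lra.
Qed.

Lemma half_turn_continuous k c : continuous (half_turn k c).
Proof.
move=> t; pose g (u : C) : C := c + k * (u / (2 - u)).
apply: (@continuous_comp _ _ _ (fun t : R => (1 +i* t) : C) g).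
  exact: continuous_vline.
apply: derivable_continuous; apply: holoD; first exact: holo_cst.
apply: holoM; first exact: holo_cst.
apply: holoM; first exact: holo_id.
apply: holoV; last exact: half_turn_den.
by apply: holoB; [exact: holo_cst|exact: holo_id].
Qed.

Lemma half_turn_modulus k c t : abs (half_turn k c t - c) = abs k.
Proof.
rewrite /half_turn addrC addKr modulusM modulusM modulusV.
have -> : abs (2 - (1 +i* t)) = abs (1 +i* t).
  have -> : (2 - (1 +i* t) : C) = 1 -i* t.
    by apply/eqP; rewrite eq_complex /=; apply/andP; split; apply/eqP; lra.
  by rewrite /modulus /= sqrrN.
rewrite divff ?mulr1 // modulus_eq0; apply/eqP => /(congr1 (@complex.Re R)) /=.
by apply/eqP; exact: oner_neq0.
Qed.

Lemma half_turn_onto k c z : k != 0 -> abs (z - c) = abs k ->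
  complex.Re ((z - c) / k) <> -1 -> exists t, half_turn k c t = z.
Proof.
move=> k0 zk; set v := (z - c) / k => vN1.
have v1 : abs v = 1 by rewrite modulusM modulusV zk divff // modulus_eq0.
have : abs v ^+ 2 = 1 by rewrite v1 expr1n.
rewrite modulus_sqr => xy; exists (complex.Im v / (1 + complex.Re v)).
have x0 : 1 + complex.Re v != 0 by apply/eqP => h; apply: vN1; lra.
rewrite /half_turn (_ : _ / (2 - _) = v).
  by rewrite /v mulrC divfK // addrC subrK.
set t := complex.Im v / _; have tE : t * (1 + complex.Re v) = complex.Im v by rewrite divfK.
apply: (canLR (mulfK (half_turn_den t))).
move: t tE xy x0 {v1 vN1}; case: v => x y /= t tE xy x0.
have e1 : x + y * t = 1.
  apply: (mulIf x0); rewrite (_ : (x + y * t) * (1 + x) = x * (1 + x) + y * (t * (1 + x))); last by ring.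
  by rewrite tE; lra.
by apply/eqP; rewrite eq_complex /=; apply/andP; split; apply/eqP; lra.
Qed.

Lemma circle_connected c r : 0 < r -> connected [set z | abs (z - c) = r].
Proof.
move=> r0; have rk : abs r%:C = r by rewrite modulusC ger0_norm // ltW.
have rk0 : r%:C != 0 :> C by rewrite -modulus_gt0 rk.
have nk : abs (- r%:C) = r by rewrite modulusN.
have nk0 : - r%:C != 0 :> C by rewrite oppr_eq0.
rewrite (_ : [set z | _] = range (half_turn r%:C c) `|` range (half_turn (- r%:C) c)).
  apply: connectedU.
  - have ir : abs (c + 'i * r%:C - c) = r.
      by rewrite addrC addKr modulusM rk /modulus /= expr0n expr1n add0r sqrtr1 mul1r.
    have i1 : complex.Re ((c + 'i * r%:C - c) / r%:C) <> -1.
      by rewrite addrC addKr mulfK //=; lra.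
    have i2 : complex.Re ((c + 'i * r%:C - c) / - r%:C) <> -1.
      by rewrite addrC addKr invrN mulrN mulfK //=; lra.
    have [t tE] := half_turn_onto rk0 (etrans ir (esym rk)) i1.
    have [u uE] := half_turn_onto nk0 (etrans ir (esym nk)) i2.
    by exists (c + 'i * r%:C); split; [exists t|exists u].
  - apply: image_connected; first exact: half_turn_continuous.
    by apply/connected_intervalP => x y _ _ z _.
  - apply: image_connected; first exact: half_turn_continuous.
    by apply/connected_intervalP => x y _ _ z _.
apply/seteqP; split => z /=; last first.
  by move=> [|] [t _ <-]; rewrite half_turn_modulus ?modulusN rk.
move=> zr; have [h|h] := pselect (complex.Re ((z - c) / r%:C) = -1); last first.
  by left; have [t <-] := half_turn_onto rk0 (etrans zr (esym rk)) h; exists t.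
right; have h' : complex.Re ((z - c) / - r%:C) <> -1.
  rewrite invrN mulrN.
  have -> (u : C) : complex.Re (- u) = - complex.Re u by case: u.
  by rewrite h; lra.
by have [t <-] := half_turn_onto nk0 (etrans zr (esym nk)) h'; exists t.
Qed.

Definition seg z z' : set C := (fun t : R => z + t%:C * (z' - z)) @` `[0, 1].

Lemma seg_connected z z' : connected (seg z z').
Proof.
apply: image_connected; last exact: segment_connected.
move=> t; pose g (u : C) : C := z + u * (z' - z).
apply: (@continuous_comp _ _ _ (fun t : R => (t +i* 0) : C) g).
  exact: continuous_hline.
apply: derivable_continuous; apply: holoD; first exact: holo_cst.
by apply: holoM; [exact: holo_id|exact: holo_cst].
Qed.

Lemma seg_left z z' : seg z z' z.
Proof. by exists 0; [rewrite /= in_itv /= lexx ler01|rewrite mul0r addr0]. Qed.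

Lemma seg_right z z' : seg z z' z'.
Proof.
by exists 1; [rewrite /= in_itv /= ler01 lexx|rewrite mul1r addrC subrK].
Qed.

Lemma star_connected (A B : set C) : connected B -> B !=set0 -> B `<=` A ->
  (forall z, A z -> exists2 z', B z' & seg z z' `<=` A) -> connected A.
Proof.
move=> cB [b Bb] BA H.
rewrite (_ : A = \bigcup_(D in [set D | [/\ B `<=` D, D `<=` A & connected D]]) D).
  by apply: bigcup_connected; [exists b => D [BD _ _]; exact: BD|move=> D []].
apply/seteqP; split => z; last by move=> [D [_ DA _] /DA].
move=> Az; have [z' Bz' sA] := H z Az; exists (B `|` seg z z').
  split; first by move=> x; left.
    by move=> x [/BA|/sA].
  apply: connectedU => //; last exact: seg_connected.
  by exists z'; split => //; exact: seg_right.
by right; exact: seg_left.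
Qed.

(** Every point is joined to a fixed circle by a radial segment. *)
Lemma radial_connected (I : set R) c r : is_interval I -> I r -> 0 < r ->
  connected [set z | I (abs (z - c))].
Proof.
move=> II Ir r0.
have rk : abs r%:C = r by rewrite modulusC ger0_norm // ltW.
apply: (star_connected (@circle_connected c r r0)).
- by exists (c + r%:C); rewrite /= addrC addKr.
- by move=> z /= ->.
have key (z u : C) : abs u = 1 -> z = c + (abs (z - c))%:C * u -> I (abs (z - c)) ->
    exists2 z', abs (z' - c) = r & seg z z' `<=` [set z | I (abs (z - c))].
  move=> u1 zE Iz; exists (c + r%:C * u); first by rewrite addrC addKr modulusM u1 mulr1.
  move: zE Iz; set a := abs (z - c) => zE Iz _ [t + <-]; rewrite /= in_itv /= => /andP[t0 t1].
  have a0 : 0 <= a by exact: modulus_ge0.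
  have -> : z + t%:C * (c + r%:C * u - z) - c = (a + t * (r - a))%:C * u.
    by rewrite {1 2}zE rmorphD rmorphM rmorphB /=; ring.
  have m0 : 0 <= a + t * (r - a) by nra.
  rewrite modulusM u1 mulr1 modulusC ger0_norm //.
  have [ra|ra] := leP r a.
    by apply: (II r a) => //; apply/andP; split; nra.
  by apply: (II a r) => //; apply/andP; split; nra.
move=> z /= Iz; have [zc|zc] := eqVneq z c.
  apply: (key z 1) => //; first exact: modulus1.
  by rewrite zc subrr modulus0 mul0r addr0.
have zc0 : abs (z - c) != 0 by rewrite modulus_eq0 subr_eq0.
have zcC : (abs (z - c))%:C != 0 :> C by rewrite -modulus_eq0 modulusC normr_eq0.
apply: (key z ((abs (z - c))%:C^-1 * (z - c))) => //.
  by rewrite modulusM modulusV modulusC ger0_norm ?modulus_ge0 // mulVf.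
by rewrite mulrA divff // mul1r addrC subrK.
Qed.

Lemma closed_disc_thicken (U : set C) c s : open U -> 0 < s ->
  (forall z, abs (z - c) <= s -> U z) ->
  exists2 s', s < s' & forall z, abs (z - c) < s' -> U z.
Proof.
move=> oU s0 sU.
have cabs : continuous (fun z => abs (z - c)).
  by apply: continuous_modulus_comp => z; apply: holoB; [exact: holo_id|exact: holo_cst].
pose K := [set z | abs (z - c) <= s + 1] `&` ~` U.
have cK : compact K.
  apply: (@closed_bounded_compact _ _ (abs c + s + 1)).
    apply: closedI; last exact: open_closedC.
    by apply: closed_le_fun => // z; exact: real_continuous_cst.
  move=> z [/= zs _]; have := modulusD c (z - c); rewrite addrC subrK addrC; lra.
have [K0|/set0P K0] := eqVneq K set0.
  exists (s + 1); first by lra.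
  move=> z zs; apply: contrapT => nUz; have : K z by split => //=; exact: ltW.
  by rewrite K0.
have [m /set_mem[/= mK nUm] mP] := compact_EVT_min K0 cK (continuous_subspaceT cabs).
exists (abs (m - c)).
  by rewrite ltNge; apply/negP => /sU.
move=> z zm; apply: contrapT => nUz.
have : abs (m - c) <= abs (z - c).
  by apply: mP; apply/mem_set; split => //=; apply: ltW; apply: lt_le_trans mK.
by rewrite leNgt zm.
Qed.

(** An annulus around the disc is connected and hence lies on one side of any
    bipartition; that side can then be enlarged by the disc. *)
Lemma connected_remove_disc (U : set C) c s : open U -> connected U -> 0 < s ->
  (forall z, abs (z - c) <= s -> U z) ->
  connected (U `&` [set z | s < abs (z - c)]).
Proof.
move=> oU cU s0 sU; set V := U `&` _.
have cabs : continuous (fun z => abs (z - c)).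
  by apply: continuous_modulus_comp => z; apply: holoB; [exact: holo_id|exact: holo_cst].
have oV : open V.
  apply: openI => //; rewrite (_ : [set z | _] = (fun z => abs (z - c)) @^-1` [set x | s < x]) //.
  by apply: open_comp; [move=> z _; exact: cabs|exact: open_gt].
have [s' ss' s'U] := closed_disc_thicken oU s0 sU.
pose D := [set z | abs (z - c) < s'].
have oD : open D.
  rewrite (_ : D = (fun z => abs (z - c)) @^-1` [set x | x < s']) //.
  by apply: open_comp; [move=> z _; exact: cabs|exact: open_lt].
pose N := [set z | (fun x => s < x < s') (abs (z - c))].
have cN : connected N.
  apply: (@radial_connected (fun x => s < x < s') c ((s + s') / 2)); [|apply/andP; split; lra|lra].
  by move=> x y /andP[x1 x2] /andP[y1 y2] z /andP[z1 z2]; apply/andP; split; lra.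
have NV : N `<=` V by move=> z /andP[z1 z2]; split => //; exact: s'U.
have Uc : U c by apply: sU; rewrite subrr modulus0 ltW.
have nVc : ~ V c by move=> [_ /=]; rewrite subrr modulus0; lra.
(* a bipartition of V into two open sets extends to U across the disc *)
have split2 (X Y : set C) : open X -> open Y -> X `&` Y = set0 -> V = X `|` Y ->
    N `<=` X -> Y = set0.
  move=> oX oY XY VXY NX.
  have XYs : separated (X `|` D) Y.
    apply: open_separated => //; first exact: openU.
    apply/seteqP; split => z // [[Xz|Dz] Yz]; first by rewrite -XY.
    have [_ zs] : V z by rewrite VXY; right.
    by rewrite -XY; split => //; apply: NX; apply/andP.
  have sub : U `<=` (X `|` D) `|` Y.
    move=> z Uz; have [zs|zs] := leP (abs (z - c)) s.
      by left; right; exact: le_lt_trans zs ss'.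
    have : V z by [].
    by rewrite VXY => -[Xz|Yz]; [left; left|right].
  have [UX|UY] := connected_subset XYs sub cU; last first.
    by exfalso; apply: nVc; rewrite VXY; right; exact: UY.
  apply/seteqP; split => z // Yz; have [Uz zs] : V z by rewrite VXY; right.
  rewrite -(separated_disjoint XYs); split => //; exact: UX.
move=> B B0 [C1 oC1 BE1] [C2 cC2 BE2].
pose Y := V `&` ~` C2.
have oB : open B by rewrite BE1; exact: openI.
have oY : open Y by apply: openI => //; exact: closed_openC.
have BY : B `&` Y = set0.
  by rewrite BE2; apply/seteqP; split => z // [[_ z2] [_ nz2]].
have VBY : V = B `|` Y.
  rewrite BE2; apply/seteqP; split => z; last by move=> [[]|[]].
  by move=> Vz; have [z2|z2] := pselect (C2 z); [left|right].
have NBY : N `<=` B `|` Y by rewrite -VBY.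
have [NB|NY] := connected_subset (open_separated oB oY BY) NBY cN.
  by rewrite VBY (split2 B Y) ?setU0.
exfalso; have : B = set0 by apply: (split2 Y B) => //; [rewrite setIC|rewrite setUC].
by have [z Bz] := B0; move=> Be; rewrite Be in Bz.
Qed.

End radial.

(** * Topology of the circular domain *)

Lemma complex_prim_root_exists (R : realType) (n : nat) : (0 < n)%N ->
  exists w : R[i], n.-primitive_root w.
Proof.
pose p : {poly R[i]} := 'X^n - 1; have [r Dp] := closed_field_poly_normal p.
move=> n_gt0; rewrite (monicP _) ?monicXnsubC // scale1r in Dp.
have rn1 : all n.-unity_root r by apply/allP=> z; rewrite -root_prod_XsubC -Dp.
have sz_r : (n < (size r).+1)%N.
  by rewrite -(size_prod_XsubC r id) -Dp size_XnsubC.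
have [|z] := hasP (cyclic.has_prim_root n_gt0 rn1 _ sz_r); last by exists z.
rewrite -separable.separable_prod_XsubC -Dp cyclotomic.separable_Xn_sub_1 //.
by rewrite pnatr_eq0 -lt0n.
Qed.

(** Shows that |1 + a z| <= e |z| is a disc (of Apollonius) when e < |a|. *)
Lemma apollonius_identity (R : realType) (a z : R[i]^o) (e D : R) :
  modulus a ^+ 2 - e ^+ 2 = D -> D != 0 ->
  D * (modulus (z - - (D^-1%:C * conjc a)) ^+ 2 - (e / D) ^+ 2) =
  modulus (1 + a * z) ^+ 2 - (e * modulus z) ^+ 2.
Proof.
move=> De Dn0; have h : D * D^-1 = 1 by rewrite divff.
rewrite !exprMn !modulus_sqr in De *; move: (D^-1) h => E h.
case: a De z => [p q] /= De [x y] /=.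
have e2 : e ^+ 2 = p ^+ 2 + q ^+ 2 - D by lra.
rewrite e2.
rewrite (_ : D * _ = D * (x ^+ 2 + y ^+ 2) + 2 * (D * E) * (x * p - y * q) +
  (D * E) ^+ 2); last by ring.
by rewrite h; ring.
Qed.

Section domain.
Variable R : realType.
Local Notation C := (R[i]^o).
Local Notation abs := (@modulus R).
Variables (n : nat) (w : C) (e d : R).
Hypotheses (wn : n.-primitive_root w) (e0 : 0 < e) (ed : 2 * e < d).
Hypothesis dP : forall i j : 'I_n, i != j -> d <= abs (w ^+ i - w ^+ j).

Definition hole j : set C := [set z | abs (root_factor w j z) <= e * abs z].

Let n0 : (0 < n)%N. Proof. exact: prim_order_gt0 wn. Qed.

Lemma hole0E : hole 0 = [set z | e^-1 <= abs (z - 0)].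
Proof.
apply/seteqP; split => z; rewrite /hole /= /root_factor expr0 mul1r addrK modulus1 subr0;
  by rewrite mulrC -ler_pdivrMr // div1r.
Qed.

Lemma hole_disc j : (0 < j < n)%N ->
  exists c s, 0 < s /\ hole j = [set z | abs (z - c) <= s].
Proof.
move=> /andP[j0 jn]; pose a : C := 1 - w ^+ j.
have ad : d <= abs a.
  have := @dP (Ordinal n0) (Ordinal jn); rewrite /= expr0; apply.
  by apply/eqP => /(congr1 val) /= h; rewrite -h in j0.
have d0 : 0 < d by apply: lt_trans ed; rewrite mulr_gt0.
have a0 : 0 < abs a by exact: lt_le_trans ad.
(* positive since |a| >= d > 2 e *)
pose D := abs a ^+ 2 - e ^+ 2.
have D0 : 0 < D.
  rewrite subr_gt0 ltr_pXn2r ?nnegrE ?modulus_ge0 ?(ltW e0) //.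
  by have := e0; have := ed; lra.
exists (- (D^-1%:C * conjc a)), (e / D); split; first by rewrite divr_gt0.
have key z : D * (abs (z - - (D^-1%:C * conjc a)) ^+ 2 - (e / D) ^+ 2) =
    abs (root_factor w j z) ^+ 2 - (e * abs z) ^+ 2.
  have -> : root_factor w j z = 1 + a * z by rewrite /root_factor /a; ring.
  by apply: apollonius_identity; rewrite // gt_eqF.
apply/seteqP; split => z /=; rewrite /hole /= => h.
- rewrite -(@ler_pXn2r _ 2) ?nnegrE ?modulus_ge0 ?divr_ge0 ?(ltW e0) ?(ltW D0) //.
  rewrite -subr_le0 -(pmulr_rle0 _ D0) key subr_le0.
  by apply: lerXn2r => //; rewrite nnegrE ?modulus_ge0 // mulr_ge0 ?modulus_ge0 // ltW.
- rewrite -(@ler_pXn2r _ 2) ?nnegrE ?modulus_ge0 ?mulr_ge0 ?modulus_ge0 ?(ltW e0) //.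
  rewrite -subr_le0 -key pmulr_rle0 // subr_le0.
  by apply: lerXn2r => //; rewrite nnegrE ?modulus_ge0 // divr_ge0 // ltW.
Qed.

(** Two roots of unity are at distance at least d > 2 e, so that zeta is close to
    at most one of them. *)
Lemma holes_disjoint i j z : (i < n)%N -> (j < n)%N -> i <> j ->
  hole i z -> hole j z -> False.
Proof.
move=> iN jN ij hi hj.
have := @root_factor_sep R n w d dP (Ordinal iN) (Ordinal jN) z; rewrite /= => /(_ _) h.
have {}h : d * abs z <= abs (root_factor w i z) + abs (root_factor w j z).
  by apply: h; apply/eqP => /(congr1 val).
move: hi hj; rewrite /hole /= => hi hj.
have z0 : z = 0.
  apply/eqP; rewrite -modulus_eq0 eq_le modulus_ge0 andbT leNgt; apply/negP => z0.
  by have := ed; nra.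
by move: hi; rewrite z0 /root_factor mulr0 addr0 subr0 modulus0 modulus1 mulr0; lra.
Qed.

Definition partial_domain k : set C := [set z | forall j, (j < k)%N -> e * abs z < abs (root_factor w j z)].

Lemma circ_domainE : circ_domain n w e = partial_domain n.
Proof.
apply/seteqP; split => z /= H j; last exact: H.
by move=> jn; exact: (H (Ordinal jn)).
Qed.

Lemma partial_domainS k : partial_domain k.+1 = partial_domain k `&` [set z | e * abs z < abs (root_factor w k z)].
Proof.
apply/seteqP; split => z /= H.
  by split => [j jk|]; apply: H => //; exact: ltnW.
by move=> j; rewrite ltnS leq_eqVlt => /orP[/eqP ->|]; case: H => // H _; exact: H.
Qed.

Lemma continuous_linear_modulus : continuous (fun z => e * abs z).
Proof.
by move=> z; apply: real_continuous_ptM; [exact: real_continuous_cst|exact: continuous_modulus].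
Qed.

Lemma continuous_root_factor_modulus j : continuous (fun z => abs (root_factor w j z)).
Proof. by apply: continuous_modulus_comp => z; exact: derivable_root_factor. Qed.

Lemma closed_hole j : closed (hole j).
Proof.
apply: closed_le_fun; [exact: continuous_root_factor_modulus|exact: continuous_linear_modulus].
Qed.

Lemma partial_domain_open k : open (partial_domain k).
Proof.
elim: k => [|k IH].
  by rewrite (_ : partial_domain 0 = setT); [exact: openT|apply/seteqP; split].
rewrite partial_domainS; apply: openI => //.
rewrite (_ : [set z | _] = ~` hole k); first by apply: closed_openC; exact: closed_hole.
by apply/seteqP; split => z /=; rewrite /hole /= ltNge => /negP.
Qed.

(** The holes are removed one at a time from the disc |z| < 1/e. *)
Lemma partial_domain_connected k : (0 < k <= n)%N -> connected (partial_domain k).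
Proof.
move=> /andP[]; elim: k => // k IH _ kn; have [k0|k0] := posnP k.
  rewrite k0 (_ : partial_domain 1 = [set z | (fun x => x < e^-1) (abs (z - 0))]).
    apply: (@radial_connected R (fun x => x < e^-1) 0 (e^-1 / 2)).
    - by move=> x y _ y1 t /andP[_ ty]; exact: le_lt_trans ty y1.
    - have : 0 < e^-1 by rewrite invr_gt0.
      by lra.
    - by rewrite divr_gt0 ?invr_gt0.
  rewrite partial_domainS; apply/seteqP; split => z /=;
    rewrite /root_factor expr0 mul1r addrK modulus1 subr0 mulrC -ltr_pdivlMr // div1r.
    by case.
  by move=> zs; split.
have kn' : (0 < k < n)%N by rewrite k0.
have [c [s [s0 hE]]] := hole_disc kn'.
rewrite partial_domainS (_ : [set z | _] = [set z | s < abs (z - c)]); last first.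
  have hN z : hole k z <-> abs (z - c) <= s by rewrite hE.
  apply/seteqP; split => z /= h; rewrite ltNge; apply/negP => /hN;
    by rewrite /hole /= leNgt h.
apply: connected_remove_disc => //; first exact: partial_domain_open.
  by apply: IH => //; exact: ltnW.
move=> z zs j jk; rewrite ltNge; apply/negP => hj.
have hk : hole k z by rewrite hE.
apply: (@holes_disjoint j k z) => //.
- exact: ltn_trans jk kn.
- by move=> jk'; rewrite jk' ltnn in jk.
Qed.

Lemma circ_domain_domain : domain (circ_domain n w e).
Proof.
split; first by rewrite circ_domainE; exact: partial_domain_open.
  by exists 0; exact: circ_domain0.
by rewrite circ_domainE; apply: partial_domain_connected; rewrite n0 leqnn.
Qed.

Lemma hole_bounded_compact j : (0 < j < n)%N -> compact (hole j).
Proof.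
move=> /hole_disc[c [s [s0 hE]]].
apply: (@closed_bounded_compact _ _ (abs c + s)); first exact: closed_hole.
move=> z; rewrite hE /= => zs.
by have := modulusD c (z - c); rewrite addrC subrK addrC; lra.
Qed.

Lemma hole_connected j : (j < n)%N -> connected (hole j).
Proof.
have [->|j0] := posnP j => jn.
  rewrite hole0E; apply: (@radial_connected R (fun x => e^-1 <= x) 0 e^-1).
  - by move=> x y x1 _ t /andP[xt _]; exact: le_trans x1 xt.
  - exact: lexx.
  - by rewrite invr_gt0.
have [|c [s [s0 ->]]] := @hole_disc j; first by rewrite j0.
apply: (@radial_connected R (fun x => x <= s) c s) => //.
by move=> x y _ y1 t /andP[_ ty]; exact: le_trans ty y1.
Qed.

Lemma hole_nonempty j : (j < n)%N -> hole j !=set0.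
Proof.
have [->|j0] := posnP j => jn.
  have ei : abs (e^-1)%:C = e^-1 by rewrite modulusC ger0_norm // invr_ge0 ltW.
  exists (e^-1)%:C; rewrite hole0E.
  have : e^-1 <= abs ((e^-1)%:C - 0); last by [].
  by rewrite subr0 ei.
have [|c [s [s0 ->]]] := @hole_disc j; first by rewrite j0.
by exists c; rewrite /= subrr modulus0 ltW.
Qed.

Let opc := one_point_compactification C.
Let sphere_hole j : set opc := closure (Some @` hole j : set opc).

Lemma sphere_hole_Some j z : sphere_hole j (Some z) -> hole j z.
Proof.
move=> cl; apply: contrapT => nh.
have oh : open (~` hole j) by apply: closed_openC; exact: closed_hole.
have : nbhs (Some z : opc) (Some @` (~` hole j)).
  by apply: one_point_compactification_some_nbhs; exact: open_nbhs_nbhs.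
by move=> /cl[_ [[u hu <-] [v nv [vu]]]]; apply: nv; rewrite vu.
Qed.

Lemma sphere_hole_infty j : (0 < j < n)%N -> ~ sphere_hole j None.
Proof.
move=> jn cl.
have : nbhs (None : opc) ((Some @` (~` hole j)) `|` [set None]).
  by exists (hole j) => //; split; [exact: hole_bounded_compact|exact: closed_hole].
move=> /cl[_ [[u hu <-] [[v nv [vu]]|//]]]; by apply: nv; rewrite vu.
Qed.

Lemma sphere_hole0_infty : sphere_hole 0 None.
Proof.
move=> V [W [cW _] WV]; have [B B0 WB] := compact_bounded cW.
pose b := Num.max (B + 1) e^-1.
have b0 : 0 <= b by rewrite le_max; apply/orP; left; lra.
have bb : abs b%:C = b by rewrite modulusC ger0_norm.
exists (Some b%:C); split.
  exists b%:C => //; rewrite hole0E.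
  have : e^-1 <= abs (b%:C - 0); last by [].
  by rewrite subr0 bb le_max lexx orbT.
apply: WV; left; exists b%:C => // /WB; rewrite bb leNgt => /negP; apply.
by rewrite lt_max; apply/orP; left; lra.
Qed.

(** The components of the complement are the closures of the holes in the
    sphere; the closure adds the point at infinity to the hole of index 0 and
    nothing to the other ones. *)
Lemma circ_domain_connectivity : has_connectivity (circ_domain n w e) n.
Proof.
rewrite /has_connectivity.
rewrite (_ : ~` _ = \bigcup_(i in `I_n) sphere_hole i).
  apply: card_components.
  - by move=> i _; exact: closed_closure.
  - move=> i ilt; apply: connected_closure; apply: connected_continuous_connected.
      exact: hole_connected.
    by apply: continuous_subspaceT; exact: one_point_compactification_some_continuous.
  - move=> i /hole_nonempty[z hz]; exists (Some z); apply: subset_closure.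
    by exists z.
  - move=> i j ilt jlt ij; apply/seteqP; split => -[z|] // [hi hj].
      exact: (holes_disjoint ilt jlt ij (sphere_hole_Some hi) (sphere_hole_Some hj)).
    have [i0|i0] := posnP i; last by apply: (@sphere_hole_infty i) => //; rewrite i0.
    have [j0|j0] := posnP j; first by rewrite i0 j0 in ij.
    by apply: (@sphere_hole_infty j) => //; rewrite j0.
apply/seteqP; split => -[z|].
- move=> nO; apply: contrapT => nh; apply: nO; exists z => // j.
  rewrite ltNge; apply/negP => hj; apply: nh; exists j; first exact: ltn_ord.
  by apply: subset_closure; exists z.
- by move=> _; exists 0%N => //; exact: sphere_hole0_infty.
- move=> [i ilt /sphere_hole_Some hi] [v Ov [vz]].
  by have := Ov (Ordinal ilt); rewrite vz /= ltNge => /negP; apply.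
- by move=> _ [].
Qed.

End domain.

(** * Disconnected Caratheodory balls *)

Theorem theorem1p1 (R : realType) (g : nat) (hg : (2 <= g)%N) :
  exists Omega : set (R[i]^o),
    domain Omega /\ has_connectivity Omega g.+1 /\
    exists (r1 r2 : R) (z0 : R[i]^o),
      0 < r2 /\ r2 < r1 /\ Omega z0 /\
      (~ connected (cball Omega z0 r1) /\
       relatively_compact_in Omega (cball Omega z0 r1)) /\
      closure_in Omega (cball Omega z0 r2) `<` closed_cball Omega z0 r2.
Proof.
pose n := g.+1.
have n2 : (2 < n)%N by [].
have [w wn] := @complex_prim_root_exists R n isT.
have [d d0 dP] := roots_separated wn.
have [e [e0 ed e12 [rho [/andP[rho0 rho1] center bar [k /andP[k0 k1] kP]]]]] :=
  barrier_gap wn n2 d0 dP.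
set Omega := circ_domain n w e in center bar kP.
have dom_Omega : domain Omega by exact: (circ_domain_domain wn e0 ed dP).
have [oO _ _] := dom_Omega.
pose c z := mobius_dist Omega z 0.
pose abs := @modulus R.
pose at_ (x : R) := ln ((1 + x) / (1 - x)) / 2.
have O0 : Omega 0 by exact: circ_domain0.
have c0 z : Omega z -> 0 <= c z by exact: mobius_ge0.
have ballE x z : 0 <= x < 1 -> cball Omega 0 (at_ x) z <-> Omega z /\ c z < x.
  by move=> x01; split => -[Oz h]; split => //; move: h;
    rewrite /caratheodory_dist /at_ artanh_lt //; exact: c0.
have cballE x z : 0 <= x < 1 -> closed_cball Omega 0 (at_ x) z <-> Omega z /\ c z <= x.
  by move=> x01; split => -[Oz h]; split => //; move: h;
    rewrite /caratheodory_dist /at_ artanh_le //; exact: c0.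
(* the region around the second centre enclosed by the barrier *)
pose r : R := 1 / 12.
pose K : set (R[i]^o) := [set z | abs (1 + z) <= r * abs z].
pose U : set (R[i]^o) := [set z | abs (1 + z) < r * abs z].
have KO : K `<=` Omega.
  move=> z Kz j; have z0 : 0 < abs z.
    rewrite lt_neqAle modulus_ge0 andbT eq_sym /abs; apply/negP => /eqP z0; move: Kz.
    rewrite /K /= /abs z0 mulr0; move/eqP: z0; rewrite modulus_eq0 => /eqP ->.
    by rewrite addr0 modulus1 ler10.
  have := modulus_leB (w ^+ j * z) (1 + z).
  rewrite modulusB -/(root_factor w j z) modulusM (root_modulus wn) mul1r.
  move: Kz; rewrite /K /r /abs /= => Kz; rewrite /abs in z0; nra.
have crz : continuous (fun z : R[i]^o => r * abs z).
  by move=> z; apply: real_continuous_ptM; [exact: real_continuous_cst|exact: continuous_modulus].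
have c1z : continuous (fun z : R[i]^o => abs (1 + z)).
  by apply: continuous_modulus_comp => z; apply: holoD; [exact: holo_cst|exact: holo_id].
have closedK : closed K by exact: closed_le_fun.
have cK : compact K.
  apply: (@closed_bounded_compact _ _ 2) => // z; rewrite /K /r /abs /= => Kz.
  have := modulus_leB z (-1); rewrite opprK addrC modulusN modulus1 addrC.
  by rewrite [z + 1]addrC; lra.
have oU : open U.
  rewrite (_ : U = (fun z => abs (1 + z) - r * abs z) @^-1` [set x | x < 0]).
    apply: open_comp; last exact: open_lt.
    by move=> z _; exact: (cvgB (c1z z) (crz z)).
  by apply/seteqP; split => z /=; rewrite /U /= subr_lt0.
have UN1 : U (-1).
  have : abs (1 + -1) < r * abs (-1); last by [].
  by rewrite /abs subrr modulus0 modulusN modulus1 /r; lra.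
have nU0 : ~ U 0.
  move=> U0; have : abs (1 + 0) < r * abs 0 by exact: U0.
  by rewrite /abs addr0 modulus0 modulus1 mulr0 ltr10.
have UK : U `<=` K by move=> z /ltW.
have ON1 : Omega (-1) by apply: KO; exact: UK.
have KU z : K z -> c z < rho -> U z.
  move=> Kz cz; rewrite /U /=; move: (Kz); rewrite /K /= le_eqVlt => /orP[/eqP zr|//].
  by have := bar z (KO z Kz) zr; rewrite leNgt cz.
have [m Km mP] : exists2 m, K m & forall z, K z -> c m <= c z.
  apply: lsc_attains_min => //.
  - by exists (-1); exact: UK.
  - by move=> z /KO; exact: c0.
  - move=> t z clz; have Kz : K z.
      by rewrite ((closure_id K).1 closedK); apply: closureS clz => v [].
    by apply: (mobius_lsc (KO z Kz) clz) => v [/KO].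
have cm : c m < rho by apply: le_lt_trans center; apply: mP; exact: UK.
have Um : U m by exact: KU.
have m0 : m != 0.
  by apply/eqP => m0; apply: nU0; rewrite -m0.
have cm0 : 0 < c m.
  apply: lt_le_trans (mobius_dist_ge_sum d0 e0 dP (KO m Km)).
  apply: mulr_gt0; first by rewrite divr_gt0 // sum_cst_gt0.
  rewrite /inv_dist_sum (bigD1 ord0) //=.
  rewrite ltr_pwDl //; last by apply: sumr_ge0 => j _; rewrite divr_ge0 ?modulus_ge0.
  by rewrite divr_gt0 // modulus_gt0 //; exact: (@root_factor_neq0 R n w e m ord0 e0 (KO m Km)).
have cm1 : 0 <= c m < 1 by rewrite (ltW cm0) (lt_trans cm).
have rho01 : 0 <= rho < 1 by rewrite (ltW rho0).
have at_lt x y : 0 <= x -> x < y -> y < 1 -> at_ x < at_ y.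
  move=> x0 xy y1; have y0 : 0 <= y by lra.
  have := @artanh_lt R x y x0; rewrite y0 y1 => /(_ isT); rewrite xy.
  by rewrite /artanh (lt_trans xy y1) lte_fin.
exists Omega; split => //; split; first exact: (circ_domain_connectivity wn e0 ed dP).
exists (at_ rho), (at_ (c m)), 0; split.
  have := at_lt 0 (c m) (lexx _) cm0; case/andP: cm1 => _ cm1 /(_ cm1).
  by rewrite /at_ addr0 subr0 divr1 ln1 mul0r.
split; first by apply: at_lt; rewrite ?(ltW cm0).
split => //; split; first split.
- (* inside the ball the closed region K coincides with the open region U *)
  move=> conn; set B := cball _ _ _ in conn.
  have B0 : B 0 by apply/(ballE rho) => //; rewrite /c mobius_refl.
  have BN1 : B (-1) by apply/(ballE rho).
  have BU : B `&` U = B.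
    apply: conn.
    - by exists (-1).
    - by exists U.
    - exists K => //; apply/seteqP; split => z [Bz].
        by move=> /UK.
      move=> Kz; split => //; apply: KU => //.
      by have /(ballE rho _ rho01)[] := Bz.
  have : (B `&` U) 0 by rewrite BU.
  by case=> _ /nU0.
- pose L : set (R[i]^o) := \bigcap_(j in [set: 'I_n]) [set z | e * abs z <= k * abs (root_factor w j z)].
  have BL : cball Omega 0 (at_ rho) `<=` L.
    by move=> z /(ballE rho _ rho01)[Oz cz] j _; exact: kP.
  have closedL : closed L.
    apply: closed_bigI => j _; apply: closed_le_fun.
      exact: continuous_linear_modulus.
    move=> z; have cd : {for z, continuous (fun z => abs (root_factor w j z))}.
      exact: continuous_root_factor_modulus.
    exact: real_continuous_ptM (@real_continuous_cst R k z) cd.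
  have LO : L `<=` Omega.
    move=> z Lz j; have := Lz j I; rewrite /= => h; apply: (le_lt_trans h).
    rewrite gtr_pMl // modulus_gt0; apply/negP => /eqP den0.
    move: h; rewrite den0 /abs modulus0 mulr0 pmulr_rle0 // => h.
    have z0 : z = 0 by apply/eqP; rewrite -modulus_eq0 eq_le h modulus_ge0.
    by move/eqP: den0; rewrite z0 /root_factor mulr0 addr0 subr0 oner_eq0.
  have cL : compact L.
    apply: (@closed_bounded_compact _ _ (k / e)) => // z Lz.
    have := Lz ord0 I; rewrite /= /root_factor /abs expr0 mul1r addrK modulus1 mulr1.
    by rewrite ler_pdivlMr // mulrC.
  have sub : closure (cball Omega 0 (at_ rho)) `<=` L.
    by rewrite ((closure_id L).1 closedL); exact: closureS.
  rewrite /relatively_compact_in /closure_in setIC setIidl; last first.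
    exact: subset_trans sub LO.
  by apply: subclosed_compact cL sub; exact: closed_closure.
- (* m belongs to the closed ball, and U is a neighbourhood of m that does not
     meet the open ball *)
  rewrite properEneq; split.
    apply/eqP => E.
    have : closed_cball Omega 0 (at_ (c m)) m by apply/(cballE (c m)) => //; split => //; exact: KO.
    rewrite -E => -[_ cl].
    have [z [/(ballE _ _ cm1)[Oz cz] Uz]] := cl U (open_nbhs_nbhs (conj oU Um)).
    by have := mP z (UK z Uz); rewrite leNgt cz.
  move=> z [Oz clz]; apply/(cballE (c m)) => //; split => //.
  apply: (mobius_lsc Oz clz) => v /(ballE _ _ cm1)[Ov cv]; split => //; exact: ltW.
Qed.
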